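(* Let $\mathcal{H}$ be a complex separable Hilbert space, let $U:\mathcal{H}\to\mathcal{H}$ be unitary, let $\psi\in\mathcal{H}$ with $\|\psi\|=1$, let $d\ge 1$ be an integer, and let $(\varphi_n)_{n\in A}$ be an orthonormal basis of $\mathcal{H}$ indexed by $A=\mathbb{Z}_+^d$ or $A=\mathbb{Z}^d$. Let $\mu_\psi^U$ be the spectral measure of $U$ and $\psi$. Then for every $p>0$, $$\tilde\beta_\psi^-(p)\ \ge\ \frac{\dim_{\mathrm H}^+(\mu_\psi^U)}{d}.$$
   Context: Notation: $\mathbb{Z}_+=\{1,2,3,\dots\}$; for $n\in A$, $|n|=|n_1|+\dots+|n_d|$. $\partial\mathbb{D}=\{z\in\mathbb{C}:|z|=1\}$. Spectral measure: $\mu_\psi^U$ is the Borel measure on $\partial\mathbb{D}$ with $\langle\psi,f(U)\psi\rangle=\int f\,d\mu_\psi^U$ for all bounded Borel $f$ on $\partial\mathbb{D}$. Dynamics: $\psi(k)=U^k\psi$, $a_\psi(n,k)=|\langle\varphi_n,\psi(k)\rangle|^2$, and $|X|^p_\psi(k)=\sum_{n\in A}(|n|^p+1)\,a_\psi(n,k)\in[1,\infty]$. For integers $K\ge1$, $\langle|X|^p_\psi\rangle(K)=\frac1K\sum_{k=0}^{K-1}|X|^p_\psi(k)$. The lower time-averaged transport exponent is $$\tilde\beta_\psi^-(p)=\liminf_{K\to\infty}\frac{\log\big(\langle|X|^p_\psi\rangle(K)\big)}{p\log K}.$$ Hausdorff measure and dimension: for $\alpha\ge0$ and $E\subseteq\partial\mathbb{D}$,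 $h^\alpha(E)=\lim_{\delta\to0^+}\inf\sum_n(\operatorname{diam}S_n)^\alpha$, where the infimum is over countable families $(S_n)$ of subsets of $\partial\mathbb{D}$ with $\operatorname{diam}S_n<\delta$ for all $n$ and $E\subseteq\bigcup_nS_n$. For nonempty $S\subseteq\partial\mathbb{D}$, $\dim_{\mathrm H}(S)=\inf\{\alpha\ge0:h^\alpha(S)=0\}$ (equivalently $\inf\{\alpha: h^\alpha(S)<\infty\}$). Upper Hausdorff dimension of a finite Borel measure $\mu$ on $\partial\mathbb{D}$: $\dim_{\mathrm H}^+(\mu)=\inf\{\dim_{\mathrm H}(S):S\subset\partial\mathbb{D}\text{ measurable},\ \mu(S)=\mu(\partial\mathbb{D})\}$. *)

(* Defs.v *)
From HB Require Import structures.
From mathcomp Require Import all_boot all_order all_algebra.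
From mathcomp Require Import sesquilinear.
From mathcomp Require Import complex.
From mathcomp Require Import all_classical all_reals all_analysis.

Set Implicit Arguments.
Unset Strict Implicit.
Unset Printing Implicit Defensive.

Import Order.TTheory GRing.Theory Num.Theory.
Import numFieldNormedType.Exports.

Local Open Scope classical_set_scope.
Local Open Scope ring_scope.
Local Open Scope complex_scope.

(* Below, Normc.normc z : R is the modulus of z, whereas `|z| : R[i]. *)
HB.instance Definition _ (R : rcfType) := NormedModule.copy R[i] R[i]^o.

Definition borel (T : topologicalType) := g_sigma_algebraType (@open T).

Definition circle (R : realType) : Type := set_type [set z : R[i] | `|z| = 1].

Section circle_instances.
Variable R : realType.

HB.instance Definition _ := Topological.copy (circle R)
  (set_type [set z : R[i] | `|z| = 1]).

Fact circle1_subproof : [set z : R[i] | `|z| = 1] 1.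
Proof. exact: normr1. Qed.

HB.instance Definition _ :=
  isPointed.Build (circle R) (exist _ 1 (mem_set circle1_subproof)).

End circle_instances.

Definition circle_val (R : realType) (z : circle R) : R[i] := set_val z.

Section hausdorff.
Variable R : realType.
Implicit Types (S E : set (circle R)) (alpha delta : R).

Definition diam S : R :=
  sup [set Normc.normc (circle_val x - circle_val y) | x in S & y in S].

(* Countable families are indexed by an arbitrary I : set nat, so that finite
   families need no padding by empty sets; this matters for alpha = 0 because
   0 `^ 0 = 1. *)
Definition hausdorff_premeasure alpha delta E : \bar R :=
  ereal_inf [set s | exists (I : set nat) (S : nat -> set (circle R)),
    [/\ forall i, I i -> diam (S i) < delta,
        E `<=` \bigcup_(i in I) S i &
        s = (\esum_(i in I) (diam (S i) `^ alpha)%:E)%E]].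

Definition hausdorff_measure alpha E : \bar R :=
  lim (hausdorff_premeasure alpha delta E @[delta --> 0^'+]).

Definition hausdorff_dim S : \bar R :=
  ereal_inf [set alpha%:E | alpha in
    [set alpha : R | 0 <= alpha /\ hausdorff_measure alpha S = 0%E]].

Definition upper_hausdorff_dim
    (mu : {finite_measure set (borel (circle R)) -> \bar R}) : \bar R :=
  ereal_inf [set hausdorff_dim S | S in
    [set S : set (borel (circle R)) | measurable S /\ mu S = mu setT]].

End hausdorff.

(* Sesquilinear forms {dot H for Num.conj} are linear in their FIRST argument;
   the inner product <x, y>, linear in y, is therefore dot y x. *)
Section hilbert.
Variables (R : realType) (H : completeNormedModType R[i]).
Variable dot : {dot H for @Num.conj R[i]}.

(* The norm of H is the one given by the inner product; as H is complete, it
   is then a Hilbert space. *)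
Definition hilbert_norm := forall x : H, `|x| ^+ 2 = dot x x.

Definition separable := exists D : set H, countable D /\ dense D.

Definition unitary (U : {linear H -> H}) :=
  isometry dot dot U /\ (forall y, exists x, U x = y).

Definition lin_span (I : choiceType) (A : set I) (phi : I -> H) : set H :=
  [set x | exists (s : seq I) (c : I -> R[i]),
    (forall i, i \in s -> A i) /\ x = \sum_(i <- s) c i *: phi i].

(* Only the values of phi on A matter. *)
Definition orthonormal_basis (I : choiceType) (A : set I) (phi : I -> H) :=
  (forall i j, A i -> A j -> dot (phi i) (phi j) = (i == j)%:R) /\
  dense (lin_span A phi).

Definition bounded_borel (f : circle R -> R[i]) :=
  measurable_fun setT (f : borel (circle R) -> borel R[i]) /\
  exists M : R, forall z, Normc.normc (f z) <= M.

(* Phi f = f(U): the Borel functional calculus of U is the unique *-homomorphism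
   from the bounded Borel functions on the circle to the bounded operators on
   H which maps the coordinate z to U and turns bounded pointwise convergence
   into strong convergence. The values of Phi outside the bounded Borel
   functions are irrelevant. *)
Record borel_calculus (U : {linear H -> H})
    (Phi : (circle R -> R[i]) -> {linear H -> H}) : Prop := BorelCalculus {
  calculus_bounded : forall f, bounded_borel f -> continuous (Phi f) ;
  calculus1 : forall x, Phi (fun=> 1) x = x ;
  calculus_id : forall x, Phi (@circle_val R) x = U x ;
  calculusD : forall f g x, bounded_borel f -> bounded_borel g ->
    Phi (fun z => f z + g z) x = Phi f x + Phi g x ;
  calculusZ : forall (c : R[i]) f x, bounded_borel f ->
    Phi (fun z => c * f z) x = c *: Phi f x ;
  calculusM : forall f g x, bounded_borel f -> bounded_borel g ->
    Phi (fun z => f z * g z) x = Phi f (Phi g x) ;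
  calculus_adj : forall f x y, bounded_borel f ->
    dot (Phi (fun z => Num.conj (f z)) x) y = dot x (Phi f y) ;
  calculus_cvg : forall (f : nat -> circle R -> R[i]) (g : circle R -> R[i]) (M : R) x,
    (forall n, bounded_borel (f n)) -> bounded_borel g ->
    (forall n z, Normc.normc (f n z) <= M) ->
    (forall z, f n z @[n --> \oo] --> g z) ->
    Phi (f n) x @[n --> \oo] --> Phi g x }.

Definition complex_integral
    (mu : {finite_measure set (borel (circle R)) -> \bar R})
    (f : circle R -> R[i]) : R[i] :=
  (\int[mu]_z complex.Re (f z)) +i* (\int[mu]_z complex.Im (f z)).

Definition spectral_measure (U : {linear H -> H}) (psi : H)
    (mu : {finite_measure set (borel (circle R)) -> \bar R}) :=
  exists2 Phi, borel_calculus U Phi &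
    forall f, bounded_borel f -> dot (Phi f psi) psi = complex_integral mu f.

End hilbert.

Definition lattice (d : nat) : set {ffun 'I_d -> int} := setT.

Definition positive_lattice (d : nat) : set {ffun 'I_d -> int} :=
  [set n | forall i, 0 < n i].

Definition lattice_norm (d : nat) (n : {ffun 'I_d -> int}) : nat :=
  (\sum_(i < d) `|n i|)%N.

Section dynamics.
Variables (R : realType) (H : completeNormedModType R[i]).
Variable dot : {dot H for @Num.conj R[i]}.
Variables (U : {linear H -> H}) (psi : H).
Variables (d : nat) (A : set {ffun 'I_d -> int}).
Variable phi : {ffun 'I_d -> int} -> H.

Definition amplitude (n : {ffun 'I_d -> int}) (k : nat) : R :=
  Normc.normc (dot (iter k U psi) (phi n)) ^+ 2.

Definition moment (p : R) (k : nat) : \bar R :=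
  (\esum_(n in A) (((lattice_norm n)%:R `^ p + 1) * amplitude n k)%:E)%E.

Definition averaged_moment (p : R) (K : nat) : \bar R :=
  ((K%:R^-1)%:E * \sum_(0 <= k < K) moment p k)%E.

(* lne +oo = +oo, so the exponent is +oo when the averaged moments are
   eventually infinite; the values at K = 0, 1 do not affect the limit. *)
Definition lower_transport_exponent (p : R) : \bar R :=
  limn_einf (fun K => lne (averaged_moment p K) / (p * ln (K%:R : R))%:E)%E.

End dynamics.

(* Main.v *)
Require Import Defs.
From mathcomp Require Import all_boot all_order all_algebra.
From mathcomp Require Import sesquilinear.
From mathcomp Require Import complex.
From mathcomp Require Import all_classical all_reals all_analysis.
From mathcomp Require Import measurable_realfun.
From mathcomp Require Import ring lra zify.

(** The transport exponent is bounded below because a piece of [psi] whose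
    spectral measure is spread out cannot stay in a small box.

    Let [alpha] be smaller than the upper Hausdorff dimension of the spectral
    measure [mu].  Cut the circle by dyadic squares of the plane.  The points
    that lie, for every [N], in some cell of side [h] and of mass larger than
    [N * h `^ alpha] can be covered by maximal such cells; these are disjoint,
    so the covering sum is at most a constant times [mu setT / N], and the set
    has zero [alpha]-dimensional Hausdorff measure.  It therefore cannot carry
    all of [mu], and some set [G] of positive mass satisfies
    [mu (G `&` cell) <= N * h `^ alpha] for every cell ([frostman],
    [good_points_cell]).

    Put [psi_on = 1_G(U) psi], whose spectral measure is [mu] restricted to
    [G].  For a trigonometric polynomial [T] of degree less than [K], summation
    by parts compares [T] at a point with partial sums of [T] at the nearest
    root of unity of order comparable with [K], and Parseval's identity at the
    roots of unity gives a large sieve inequality,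
    [\int |T|^2 dmu|_G <= C * K^(1 - alpha) * sum |c_k|^2]
    ([sampling_inequality], [integral_trig_poly]).  By the functional calculus
    the left-hand side is the squared norm of [\sum_k c_k U^k psi_on], and
    duality turns the inequality into the Strichartz estimate
    [\sum_(k < K) |<f, U^k psi_on>|^2 <= C * K^(1 - alpha) * |f|^2]
    ([strichartz]).

    Summing it over the vectors [phi n] of a box of radius [N], which has at
    most [(3 N)^d] points, shows that the time average of the squared norm of
    the projection of [U^k psi_on] on the box is at most
    [C * N^d * K^(- alpha)].  With [N] a small multiple of [K^(alpha / d)] this
    is negligible, and since [<psi_on, psi>] is the constant [mu G > 0] along
    the evolution, the Cauchy-Schwarz inequality ([dot_split_proj]) forces a
    fixed fraction of [U^k psi] to lie outside the box on average.  Hence the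
    averaged moment is at least a constant times [N^p], which is of order
    [K^(p * alpha / d)] ([averaged_moment_ge], [averaged_moment_power]), and the
    exponent is at least [alpha / d]. *)

Set Implicit Arguments.
Unset Strict Implicit.
Unset Printing Implicit Defensive.

Import Order.TTheory GRing.Theory Num.Theory.
Import numFieldNormedType.Exports.

Local Open Scope classical_set_scope.
Local Open Scope ring_scope.
Local Open Scope complex_scope.

(** * Modulus, real part and imaginary part *)

Section modulus.
Variable R : realType.
Implicit Types z w : R[i].

Lemma Re_le_normc (z : R[i]) : `|complex.Re z| <= Normc.normc z.
Proof.
case: z => x y /=; rewrite -sqrtr_sqr ler_sqrt ?lerDl ?sqr_ge0//.
by rewrite addr_ge0 ?sqr_ge0.
Qed.

Lemma Im_le_normc (z : R[i]) : `|complex.Im z| <= Normc.normc z.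
Proof.
case: z => x y /=; rewrite -sqrtr_sqr ler_sqrt ?lerDr ?sqr_ge0//.
by rewrite addr_ge0 ?sqr_ge0.
Qed.

Lemma normc_le_ReIm (z : R[i]) :
  Normc.normc z <= `|complex.Re z| + `|complex.Im z|.
Proof.
case: z => x y /=; rewrite -[leRHS]ger0_norm ?addr_ge0//.
rewrite -sqrtr_sqr ler_sqrt ?sqr_ge0// sqrrD -!normrX.
by rewrite !(ger0_norm (sqr_ge0 _)) lerD2r lerDl mulrn_wge0// mulr_ge0.
Qed.

Lemma normC_normc (z : R[i]) : `|z| = (Normc.normc z)%:C.
Proof. by rewrite normc_def; case: z. Qed.

Lemma continuous_Re : continuous (@complex.Re R : R[i] -> R).
Proof.
move=> z; apply: (iffRL (@cvgrPdist_le _ _ _ _ (nbhs_filter z) _ _)) => e e0.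
apply/nbhs_normP.
exists e%:C; first by rewrite /= ltcR.
move=> w /= /ltW; rewrite normC_normc lecR => /(le_trans _); apply.
by rewrite -raddfB; exact: Re_le_normc.
Qed.

Lemma continuous_Im : continuous (@complex.Im R : R[i] -> R).
Proof.
move=> z; apply: (iffRL (@cvgrPdist_le _ _ _ _ (nbhs_filter z) _ _)) => e e0.
apply/nbhs_normP.
exists e%:C; first by rewrite /= ltcR.
move=> w /= /ltW; rewrite normC_normc lecR => /(le_trans _); apply.
by rewrite -raddfB; exact: Im_le_normc.
Qed.

Lemma normc_ge0 z : 0 <= Normc.normc z.
Proof. by rewrite -lecR -normC_normc; exact: normr_ge0. Qed.

Lemma normc_sum (I : Type) (s : seq I) (F : I -> R[i]) :
  Normc.normc (\sum_(i <- s) F i) <= \sum_(i <- s) Normc.normc (F i).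
Proof.
elim/big_ind2 : _ => //; first by rewrite Normc.normc0.
by move=> x1 x2 y1 y2 h1 h2; apply: (le_trans (le_normcD _ _)); exact: lerD.
Qed.

Lemma sqr_normcE z : (Normc.normc z ^+ 2)%:C = z * z^*.
Proof. by rewrite rmorphXn /= -normC_normc normCK. Qed.

Lemma normcX z n : Normc.normc (z ^+ n) = Normc.normc z ^+ n.
Proof.
elim: n => [|n IH]; first by rewrite !expr0 Normc.normc1.
by rewrite !exprS Normc.normcM IH.
Qed.

Lemma sqr_sum_le (K : nat) (a : nat -> R) :
  (\sum_(k < K) a k) ^+ 2 <= K%:R * \sum_(k < K) a k ^+ 2.
Proof.
rewrite expr2 mulr_suml.
under eq_bigr do rewrite mulr_sumr.
apply: (@le_trans _ _ (\sum_(i < K) \sum_(j < K) (a i ^+ 2 + a j ^+ 2) / 2)).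
  apply: ler_sum => i _; apply: ler_sum => j _.
  by rewrite ler_pdivlMr//; have := sqr_ge0 (a i - a j); rewrite sqrrB; nra.
under eq_bigr do rewrite -mulr_suml big_split /= sumr_const card_ord.
rewrite -mulr_suml big_split /= sumr_const card_ord sumrMnl -mulr_natl.
by rewrite le_eqVlt; apply/orP; left; apply/eqP; field.
Qed.

End modulus.

(** * Dyadic cells on the circle *)

Section cells.
Variable R : realType.
Implicit Types (z w : circle R).

(** Squares of the plane are used in place of arcs: measurability of a cell is
    then read off the coordinates, with no measurable choice of an argument,
    and dyadic squares are nested.  Only the number of cells that meet a given
    short arc matters below, so that cells which miss the circle are
    harmless. *)
Definition cell_index (m : nat) z : int * int :=
  (Num.floor (2 ^+ m * complex.Re (circle_val z)),
   Num.floor (2 ^+ m * complex.Im (circle_val z))).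

Definition cell (m : nat) (j : int * int) : set (circle R) :=
  cell_index m @^-1` [set j].

Definition mesh (m : nat) : R := (2 ^+ m)^-1.

Lemma mesh_gt0 m : 0 < mesh m.
Proof. by rewrite invr_gt0 exprn_gt0. Qed.

Lemma continuous_circle_val : continuous (@circle_val R).
Proof. exact: initial_continuous. Qed.

Lemma open_measurable_circle (S : set (circle R)) :
  open S -> measurable (S : set (borel (circle R))).
Proof. exact: sub_sigma_algebra. Qed.

Lemma measurable_floor (f : circle R -> R) (c : R) (j : int) :
  continuous f ->
  measurable ([set z | Num.floor (c * f z) = j] : set (borel (circle R))).
Proof.
move=> fc.
have fc' : continuous (fun z => c * f z).
  move=> z; apply: (continuous_comp (f := f) (g := fun x : R => c * x)).
    exact: fc.
  exact: mulrl_continuous.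
have mlt (a : R) :
    measurable ([set z | c * f z < a] : set (borel (circle R))).
  apply: open_measurable_circle.
  have /continuousP fo := fc'.
  apply: (fo [set x : R | x < a]).
  exact (@open_lt R a).
rewrite (_ : [set z | _] =
  [set z | c * f z < (j + 1)%:~R] `\` [set z | c * f z < j%:~R]).
  exact: measurableD.
apply/seteqP; split=> z /=.
  move=> <-; split; first by rewrite floorD1_gt.
  by apply/negP; rewrite -leNgt floor_le.
by move=> [lt1 /negP]; rewrite -leNgt => le2; apply/floor_def; rewrite le2.
Qed.

Lemma measurable_cell m j : measurable (cell m j : set (borel (circle R))).
Proof.
case: j => j1 j2.
rewrite (_ : cell _ _ =
  [set z | Num.floor (2 ^+ m * complex.Re (circle_val z)) = j1] `&`
  [set z | Num.floor (2 ^+ m * complex.Im (circle_val z)) = j2]); last first.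
  by apply/seteqP; split=> z /=; [move=> [-> ->]|move=> [<- <-]].
apply: measurableI; apply: measurable_floor => z.
  apply: continuous_comp; [exact: continuous_circle_val|exact: continuous_Re].
apply: continuous_comp; [exact: continuous_circle_val|exact: continuous_Im].
Qed.

Lemma floor_dist_lt1 (x y : R) : Num.floor x = Num.floor y -> `|x - y| < 1.
Proof.
move=> exy; have := floor_le x; have := floorD1_gt x.
have := floor_le y; have := floorD1_gt y; rewrite exy !intrD => *.
by rewrite ltr_norml; apply/andP; split; lra.
Qed.

(** The half-open interval of length 1 that contains [x] is a union of intervals
    of length [1 / k] from the refined grid. *)
Lemma floor_mul_nat (k : nat) (x y : R) : (0 < k)%N ->
  Num.floor (k%:R * x) = Num.floor (k%:R * y) -> Num.floor x = Num.floor y.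
Proof.
move=> k0 exy; apply/esym/floor_def.
have kR : 0 < k%:R :> R by rewrite ltr0n.
apply/andP; split.
  have : k%:R * (Num.floor x)%:~R <= k%:R * x :> R.
    by rewrite ler_pM2l// floor_le.
  have -> : k%:R * (Num.floor x)%:~R = (k%:Z * Num.floor x)%:~R :> R.
    by rewrite intrM.
  rewrite -floor_ge_int exy floor_ge_int intrM.
  by rewrite ler_pM2l.
have : k%:R * x < k%:R * (Num.floor x + 1)%:~R :> R.
  by rewrite ltr_pM2l// floorD1_gt.
have -> : k%:R * (Num.floor x + 1)%:~R = (k%:Z * (Num.floor x + 1))%:~R :> R.
  by rewrite intrM.
rewrite -floor_lt_int exy floor_lt_int intrM.
by rewrite ltr_pM2l.
Qed.

Lemma cell_index_nested m m' z w : (m <= m')%N ->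
  cell_index m' z = cell_index m' w -> cell_index m z = cell_index m w.
Proof.
move=> mm' [e1 e2].
have e (x : R) : 2 ^+ m' * x = (2 ^ (m' - m))%:R * (2 ^+ m * x).
  by rewrite natrX mulrA -exprD subnK.
by congr pair; apply: (@floor_mul_nat (2 ^ (m' - m)));
  rewrite ?expn_gt0// -!e.
Qed.

Lemma cell_dist m z w : cell_index m z = cell_index m w ->
  Normc.normc (circle_val z - circle_val w) <= 2 * mesh m.
Proof.
move=> [e1 e2]; apply: (le_trans (normc_le_ReIm _)).
rewrite mulr_natl mulr2n !raddfB.
have h (x y : R) : Num.floor (2 ^+ m * x) = Num.floor (2 ^+ m * y) ->
    `|x - y| <= mesh m.
  move=> /floor_dist_lt1; rewrite -mulrBr normrM ger0_norm ?exprn_ge0//.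
  rewrite -ltr_pdivlMl ?exprn_gt0// mulr1 => /ltW; exact.
by apply: lerD; apply: h.
Qed.

Lemma diam_cell m j : diam (cell m j) <= 2 * mesh m.
Proof.
have [-> | /set0P [z zj]] := eqVneq (cell m j) set0.
  rewrite /diam (_ : [set _ | _ in _ & _ in _] = set0).
    by rewrite sup0 mulr_ge0// ltW ?mesh_gt0.
  by apply/seteqP; split=> // x /= [? []].
apply: sup_le_ub.
  by exists (Normc.normc (circle_val z - circle_val z)), z => //; exists z.
move=> _ [x xj [y yj <-]]; apply: cell_dist.
by rewrite xj yj.
Qed.

Lemma diam_ge0 (S : set (circle R)) : 0 <= diam S.
Proof.
rewrite /diam; set D := (X in sup X).
have [-> | /set0P [z zj]] := eqVneq D set0; first by rewrite sup0.
have [hs|/sup_out->//] := pselect (has_sup D).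
have [x Sx [y Sy _]] := zj.
apply: (le_trans (y := Normc.normc (circle_val x - circle_val x))).
  by rewrite -lecR -normC_normc; exact: normr_ge0.
by apply: ub_le_sup; [case: hs|exists x => //; exists x].
Qed.

End cells.

(** * Points with heavy cells and Hausdorff dimension *)

Section frostman.
Variables (R : realType) (mu : {finite_measure set (borel (circle R)) -> \bar R}).
Variable alpha : R.
Hypothesis alpha0 : 0 < alpha.

Definition heavy (N : nat) (z : circle R) (m : nat) : bool :=
  ((N%:R * mesh R m `^ alpha)%:E < mu (cell m (cell_index m z)))%E.

Definition bad_points : set (circle R) :=
  [set z | forall N, exists m, heavy N z m].

Lemma heavy_cell N z w m : cell_index m z = cell_index m w ->
  heavy N z m = heavy N w m.
Proof. by rewrite /heavy => ->. Qed.

(** The maximal heavy cell around a point is the one of least generation. *)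
Definition first_heavy N (z : circle R) (m : nat) : Prop :=
  heavy N z m /\ forall m', heavy N z m' -> (m <= m')%N.

(** Covers of a set are indexed by natural numbers, so cells are named by the
    code of the pair of their generation and index. *)
Definition stopping_cells N : set nat :=
  [set i | exists m z, i = pickle (m, cell_index m z) /\ first_heavy N z m].

Definition cell_of_code (i : nat) : set (circle R) :=
  if unpickle i is Some mj then cell mj.1 mj.2 else set0.

Lemma cell_of_codeE m j : cell_of_code (pickle (m, j)) = cell m j.
Proof. by rewrite /cell_of_code pickleK. Qed.

(** Cells of earlier generations that contain one of two points of a common cell
    contain both, so being a maximal heavy cell does not depend on the point. *)
Lemma first_heavy_cell N z w m : cell_index m z = cell_index m w ->
  first_heavy N z m -> first_heavy N w m.
Proof.
move=> e [hz mz]; split; first by rewrite -(heavy_cell _ e).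
move=> m' hw; rewrite leqNgt; apply/negP => m'm.
have e' := cell_index_nested (ltnW m'm) e.
by move: hw; rewrite -(heavy_cell _ e') => /mz; rewrite leqNgt m'm.
Qed.

Lemma stopping_cells_disjoint N :
  trivIset (stopping_cells N) cell_of_code.
Proof.
move=> _ _ [m [z [-> fz]]] [m' [w [-> fw]]].
rewrite !cell_of_codeE => -[x [xz xw]].
have fz' : first_heavy N x m by apply: first_heavy_cell fz.
have fw' : first_heavy N x m' by apply: first_heavy_cell fw.
have mm : m = m'.
  apply/eqP; rewrite eqn_leq; case: fz' => hx mx; case: fw' => hx' mx'.
  by rewrite mx// mx'.
by rewrite -(xz : cell_index m x = _) -(xw : cell_index m' x = _) mm.
Qed.

Lemma bad_points_cover N :
  bad_points `<=` \bigcup_(i in stopping_cells N) cell_of_code i.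
Proof.
move=> z /(_ N) ex; case: (ex_minnP ex) => m hm mm.
exists (pickle (m, cell_index m z)); first by exists m, z.
by rewrite cell_of_codeE.
Qed.

Lemma stopping_cells_measurable N i : stopping_cells N i ->
  measurable (cell_of_code i : set (borel (circle R))).
Proof.
by move=> [m [z [-> _]]]; rewrite cell_of_codeE; exact: measurable_cell.
Qed.

Let M : R := fine (mu setT).

Let muT : mu setT = M%:E.
Proof. by rewrite fineK// fin_num_measure. Qed.

Lemma mu_le_total (S : set (borel (circle R))) :
  measurable S -> (mu S <= M%:E)%E.
Proof. by move=> mS; rewrite -muT le_measure// inE. Qed.

(** A heavy cell satisfies [mesh R m `^ alpha < mu cell / N], and the masses of
    disjoint cells add up to at most the total mass. *)
Lemma stopping_cells_sum N : (0 < N)%N ->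
  (\esum_(i in stopping_cells N) (diam (cell_of_code i) `^ alpha)%:E <=
   (2 `^ alpha / N%:R * M)%:E)%E.
Proof.
move=> N0; have NR : 0 < N%:R :> R by rewrite ltr0n.
apply: (@le_trans _ _ (\esum_(i in stopping_cells N)
    ((2 `^ alpha / N%:R)%:E * mu (cell_of_code i)))%E).
  apply: le_esum => i [m [z [-> [hz _]]]]; rewrite cell_of_codeE.
  apply: (@le_trans _ _ ((2 `^ alpha / N%:R)%:E *
      (N%:R * mesh R m `^ alpha)%:E)%E); last first.
    apply: lee_wpmul2l; last exact: ltW.
    by rewrite lee_fin divr_ge0// powR_ge0.
  rewrite -EFinM lee_fin mulrA divfK ?gt_eqF//.
  rewrite -powRM ?(ltW (mesh_gt0 _ _))//.
  apply: ge0_ler_powR; rewrite ?nnegrE ?diam_ge0 ?diam_cell//; first exact: ltW.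
  by rewrite mulr_ge0// ltW ?mesh_gt0.
rewrite -{1}[stopping_cells N]set_mem_set -nneseries_esum; last first.
  by move=> i _; rewrite mule_ge0// lee_fin divr_ge0// powR_ge0.
rewrite nneseriesZl//.
rewrite -measure_bigcup; last 2 first.
- exact: stopping_cells_measurable.
- exact: stopping_cells_disjoint.
rewrite [leRHS]EFinM; apply: lee_wpmul2l; first by rewrite lee_fin divr_ge0// powR_ge0.
apply: mu_le_total; apply: bigcup_measurable => i; exact: stopping_cells_measurable.
Qed.

Lemma mesh_small (d : R) : 0 < d -> exists m, mesh R m < d.
Proof.
move=> d0; exists (Num.bound d^-1).
rewrite /mesh invf_plt ?posrE ?exprn_gt0//.
apply: (lt_le_trans (archi_boundP _)); first by rewrite invr_ge0 ltW.
by rewrite -natrX ler_nat ltnW// ltn_expl.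
Qed.

Lemma mesh_le m m' : (m <= m')%N -> mesh R m' <= mesh R m.
Proof.
by move=> mm; rewrite lef_pV2 ?posrE ?exprn_gt0// ler_weXn2l// ler1n.
Qed.

(** For [N] large the covering sum is below any [e]; moreover no cell of an early
    generation can be heavy, since its mass is at most the total mass, so the
    covering cells also have small diameter. *)
Lemma hausdorff_premeasure_bad_points delta : 0 < delta ->
  hausdorff_premeasure alpha delta bad_points = 0%E.
Proof.
move=> d0; apply/eqP; rewrite eq_le; apply/andP; split; last first.
  apply: le_ereal_inf_tmp => _ [I [S [_ _ ->]]].
  by apply: esum_ge0 => i _; rewrite lee_fin powR_ge0.
apply/lee_addgt0Pr => e e0; rewrite add0e.
have [m0 m0d] := mesh_small (divr_gt0 d0 (ltr0n _ 2)).
have hm0 : 0 < mesh R m0 `^ alpha by rewrite powR_gt0// mesh_gt0.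
have M0 : 0 <= M by rewrite fine_ge0// measure_ge0.
(* The first term forces heavy cells to have generation at least [m0], the second one makes
   the covering sum at most [e]. *)
pose N := (Num.bound (M / mesh R m0 `^ alpha) + Num.bound (2 `^ alpha * M / e) + 1)%N.
have N0 : (0 < N)%N by rewrite /N addn1.
have NR : 0 < N%:R :> R by rewrite ltr0n.
have N1 : M <= N%:R * mesh R m0 `^ alpha.
  have x0 : 0 <= M / mesh R m0 `^ alpha by rewrite divr_ge0// ltW.
  rewrite -ler_pdivrMr//; apply: (le_trans (ltW (archi_boundP x0))).
  by rewrite ler_nat /N -addnA leq_addr.
have N2 : 2 `^ alpha / N%:R * M <= e.
  rewrite mulrAC ler_pdivrMr// mulrC -ler_pdivrMl// mulrC.
  have x0 : 0 <= 2 `^ alpha * M / e.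
    by rewrite divr_ge0// ?mulr_ge0// ?powR_ge0// ltW.
  rewrite [leLHS]mulrC; apply: (le_trans (ltW (archi_boundP x0))).
  by rewrite ler_nat /N addnAC leq_addl.
apply: le_trans (_ : _ <= (2 `^ alpha / N%:R * M)%:E)%E _; last by rewrite lee_fin.
apply: le_trans (stopping_cells_sum N0).
apply: ereal_inf_lbound; exists (stopping_cells N), cell_of_code; split => //.
  move=> _ [m [z [-> [hz _]]]]; rewrite cell_of_codeE.
  apply: (le_lt_trans (diam_cell _ _ _)).
  rewrite -ltr_pdivlMl// mulrC; apply: le_lt_trans m0d; apply: mesh_le.
  rewrite leqNgt; apply/negP => mm0; move: hz; rewrite /heavy ltNge => /negP; apply.
  apply: (@le_trans _ _ M%:E); first by apply: mu_le_total; exact: measurable_cell.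
  rewrite lee_fin; apply: (le_trans N1); rewrite ler_pM2l//.
  apply: ge0_ler_powR; rewrite ?nnegrE ?(ltW (mesh_gt0 _ _)) ?(ltW alpha0)//.
  by rewrite mesh_le// ltnW.
exact: bad_points_cover.
Qed.

Lemma hausdorff_dim_bad_points : (hausdorff_dim bad_points <= alpha%:E)%E.
Proof.
apply: ereal_inf_lbound; exists alpha => //; split; first exact: ltW.
rewrite /hausdorff_measure; apply: cvg_lim => //.
apply: (cvg_trans _ (@cvg_cst _ (0%E : \bar R) _ (0^'+) _)).
apply: near_eq_cvg; near=> d; rewrite hausdorff_premeasure_bad_points//.
Unshelve. all: by end_near. Qed.

Definition good_points (N : nat) : set (circle R) :=
  [set z | forall m, ~~ heavy N z m].

Lemma bad_pointsE : bad_points = ~` \bigcup_N good_points N.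
Proof.
apply/seteqP; split => z /=.
  by move=> bz [N _ gz]; have [m] := bz N; rewrite (negbTE (gz m)).
move=> nz N; apply: contrapT => nex; apply: nz; exists N => // m.
by apply/negP => hm; apply: nex; exists m.
Qed.

Lemma measurable_good_points N :
  measurable (good_points N : set (borel (circle R))).
Proof.
rewrite (_ : good_points N = \bigcap_m \bigcup_(j : int * int)
   (if `[< (mu (cell m j) <= (N%:R * mesh R m `^ alpha)%:E)%E >]
    then cell m j else set0)).
  apply: bigcapT_measurable => m; apply: countable_bigcupT_measurable => // j.
  by case: ifP => // _; exact: measurable_cell.
apply/seteqP; split => z /=.
  move=> gz m _; exists (cell_index m z) => //.
  rewrite asboolT; last by have := gz m; rewrite /heavy -leNgt.
  by [].
move=> h m; have [j _] := h m Logic.I; case: asboolP => // le.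
by move=> zj; rewrite /heavy -leNgt (zj : cell_index m z = j).
Qed.

Lemma good_points_cell N m j :
  (mu (good_points N `&` cell m j) <= (N%:R * mesh R m `^ alpha)%:E)%E.
Proof.
have [->|/set0P [z [gz zj]]] := eqVneq (good_points N `&` cell m j) set0.
  by rewrite measure0 lee_fin mulr_ge0// powR_ge0.
apply: (@le_trans _ _ (mu (cell m j))).
  apply: le_measure; rewrite ?inE//; last exact: measurable_cell.
  by apply: measurableI; [exact: measurable_good_points|exact: measurable_cell].
by have := gz m; rewrite /heavy -leNgt (zj : cell_index m z = j).
Qed.

(** The bad points form a set of dimension at most [alpha]; if all the sets
    [good_points N] were null, the bad points would carry the whole mass. *)
Lemma frostman : (alpha%:E < upper_hausdorff_dim mu)%E ->
  exists N, (0 < mu (good_points N))%E.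
Proof.
move=> altd; apply: contrapT => /forallNP n0.
have : mu.-negligible (\bigcup_N good_points N : set (borel (circle R))).
  apply: negligible_bigcup => N; apply/negligibleP.
    exact: measurable_good_points.
  apply/eqP; rewrite eq_le measure_ge0 andbT leNgt; exact/negP/n0.
have mU : measurable (\bigcup_N good_points N : set (borel (circle R))).
  by apply: bigcupT_measurable => N; exact: measurable_good_points.
move=> /(measure_negligible mU) U0.
have : (upper_hausdorff_dim mu <= alpha%:E)%E.
  apply: le_trans hausdorff_dim_bad_points; apply: ereal_inf_lbound.
  exists bad_points => //; rewrite bad_pointsE; split; first exact: measurableC.
  rewrite -[RHS]sube0 -U0 -setTD measureD//; last first.
    by apply: (@le_lt_trans _ _ M%:E); [exact: mu_le_total|exact: ltry].
  by rewrite setTI.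
by rewrite leNgt altd.
Qed.

End frostman.

(** * Parametrization of the unit circle *)

Section unit_complex.
Variable R : realType.

Definition expi (t : R) : R[i] := cos t +i* sin t.

Lemma expiD s t : expi (s + t) = expi s * expi t.
Proof.
by rewrite /expi cosD sinD; apply/eqP; rewrite eq_complex /= eqxx/=; apply/eqP; ring.
Qed.

Lemma expi0 : expi 0 = 1.
Proof. by rewrite /expi cos0 sin0. Qed.

Lemma expiX t n : expi t ^+ n = expi (t *+ n).
Proof.
by elim: n => [|n IH]; rewrite ?mulr0n ?expi0// exprS mulrS expiD IH.
Qed.

Lemma normc_expi t : Normc.normc (expi t) = 1.
Proof. by rewrite /expi /= cos2Dsin2 sqrtr1. Qed.

Lemma conj_expi t : Num.conj (expi t) = expi (- t).
Proof. by rewrite /expi cosN sinN. Qed.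

Lemma expi_2pi_nat n : expi (pi *+ 2 *+ n) = 1.
Proof. by rewrite -expiX /expi cos2pi sin2pi expr1n. Qed.

(** If [cos t = 1] then [sin (`|t| / 2) = 0] by the half-angle formula, while
    [`|t| / 2] lies strictly between 0 and [pi]. *)
Lemma expi_neq1 t : 0 < `|t| < pi *+ 2 -> expi t != 1.
Proof.
move=> /andP[t0 t1]; apply/negP => /eqP [] /= ct _.
have : 0 < sin (`|t| / 2).
  apply: sin_gt0_pi; rewrite divr_gt0//= ltr_pdivrMr//.
  by rewrite mulr_natr.
have : cos `|t| = 1 by rewrite cos_norm.
rewrite -[X in cos X = _](@divfK _ 2)// mulr_natr cos_mulr2n.
rewrite cos2sin2; nra.
Qed.

Lemma cos_sin_lipschitz (s t : R) :
  `|cos s - cos t| <= `|s - t| /\ `|sin s - sin t| <= `|s - t|.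
Proof.
wlog st : s t / s <= t.
  move=> h; have [/h//|/ltW/h] := leP s t.
  by rewrite (distrC (cos t)) (distrC (sin t)) (distrC t).
have step (f df : R -> R) : (forall x : R, is_derive x 1 f (df x)) ->
    continuous f -> (forall x, `|df x| <= 1) -> `|f s - f t| <= `|s - t|.
  move=> fd fc dfb.
  have [|c _ e] := @MVT_segment R f df s t st (fun x _ => fd x).
    exact: continuous_subspaceT.
  by rewrite distrC e normrM [leRHS]distrC ler_piMl.
split.
  apply: (step cos _ (@is_derive_cos R) (@continuous_cos R)) => x.
  by rewrite normrN sin_max.
exact: (step sin _ (@is_derive_sin R) (@continuous_sin R) (@cos_max R)).
Qed.

Lemma normc_circle_val (z : circle R) : Normc.normc (circle_val z) = 1.
Proof.
have : `|circle_val z| = 1 by exact: (set_mem (valP z)).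
by rewrite normC_normc => -[].
Qed.

(** The arccosine of the real part is an argument on the upper half circle, and
    its reflection is one on the lower half circle. *)
Lemma circle_expi (z : circle R) :
  exists2 t, 0 <= t < pi *+ 2 & circle_val z = expi t.
Proof.
have := normc_circle_val z.
case: (circle_val z) => x y /= xy.
have {}xy : x ^+ 2 + y ^+ 2 = 1.
  rewrite -(sqr_sqrtr (a := _ + _)) ?xy ?expr1n//.
  by rewrite addr_ge0// sqr_ge0.
have x1 : -1 <= x <= 1 by apply/andP; split; nra.
have [y0|y0] := leP 0 y.
  exists (acos x).
    rewrite acos_ge0//=; apply: (le_lt_trans (acos_lepi x1)).
    by rewrite mulr2n ltrDl pi_gt0.
  rewrite /expi acosK ?in_itv//= sin_acos//; congr (_ +i* _).
  by rewrite -xy addrAC subrr add0r sqrtr_sqr ger0_norm.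
exists (pi *+ 2 - acos x).
  have a0 : 0 < acos x.
    apply: acos_gt0; rewrite (andP x1).1/=; nra.
  have := acos_lepi x1; have := pi_gt0 R; rewrite mulr2n => p0 ap.
  by apply/andP; split; lra.
rewrite /expi addrC cosD2pi sinD2pi cosN sinN acosK ?in_itv//= sin_acos//.
congr (_ +i* _).
by rewrite -xy addrAC subrr add0r sqrtr_sqr ltr0_norm// opprK.
Qed.

End unit_complex.

(** * Sampling trigonometric polynomials at roots of unity *)

Section sampling.
Variable R : realType.
Implicit Type c : nat -> R[i].

Definition trig_poly c (K : nat) (z : R[i]) : R[i] :=
  \sum_(k < K) c k * z ^+ k.

Definition unit_root (L j : nat) : R[i] := expi (pi *+ 2 * (j%:R / L%:R)).

(** The sum is geometric with ratio [x], where [x ^+ L = 1], and [x != 1] unless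
    [k = l]. *)
Lemma unit_root_orthogonal L (k l : 'I_L) :
  \sum_(j < L) unit_root L j ^+ k * (unit_root L j ^+ l)^* = (L * (k == l))%:R.
Proof.
have L0 : (0 < L)%N by case: L k l => // -[].
have LR : L%:R != 0 :> R by rewrite pnatr_eq0 -lt0n.
pose x : R[i] := expi (pi *+ 2 * ((k%:R - l%:R) / L%:R)).
have e (j : nat) : unit_root L j ^+ k * (unit_root L j ^+ l)^* = x ^+ j.
  rewrite /unit_root /x !expiX conj_expi -expiD; congr expi.
  set p : R := pi *+ 2.
  by rewrite -[_ *+ k]mulr_natr -[_ *+ l]mulr_natr -[RHS]mulr_natr; field.
under eq_bigr do rewrite e.
have [kl|kl] := eqVneq k l.
  under eq_bigr do rewrite /x kl subrr mul0r mulr0 expi0 expr1n.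
  by rewrite sumr_const card_ord muln1.
rewrite muln0.
have x1 : x != 1.
  apply: expi_neq1; rewrite normrM (ger0_norm (_ : 0 <= pi *+ 2)); last first.
    by rewrite mulrn_wge0// pi_ge0.
  have p0 : 0 < pi *+ 2 :> R by rewrite pmulrn_lgt0// pi_gt0.
  rewrite mulr_gt0//=; last first.
    rewrite normr_gt0 mulf_neq0 ?invr_neq0// subr_eq0 eqr_nat.
    by apply: contra kl => /eqP/val_inj ->.
  rewrite gtr_pMr// normrM normfV (ger0_norm (ler0n _ L)).
  rewrite ltr_pdivrMr ?ltr0n// mul1r ltr_norml.
  have kL := ltn_ord k; have lL := ltn_ord l.
  have : (k%:R < L%:R :> R) by rewrite ltr_nat.
  have : (l%:R < L%:R :> R) by rewrite ltr_nat.
  have := ler0n R k; have := ler0n R l.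
  by move=> *; apply/andP; split; lra.
have : (x - 1) * \sum_(j < L) x ^+ j = 0.
  rewrite -subrX1 /x expiX.
  have -> : pi *+ 2 * ((k%:R - l%:R) / L%:R) *+ L = pi *+ 2 *+ k - pi *+ 2 *+ l :> R.
    by rewrite -[_ *+ L]mulr_natr -[_ *+ k]mulr_natr -[_ *+ l]mulr_natr; field.
  by rewrite expiD -conj_expi !expi_2pi_nat rmorph1 mulr1 subrr.
by move/eqP; rewrite mulf_eq0 subr_eq0 (negbTE x1) => /eqP.
Qed.

Lemma parseval c (K L : nat) : (K <= L)%N ->
  \sum_(j < L) Normc.normc (trig_poly c K (unit_root L j)) ^+ 2 =
  L%:R * \sum_(k < K) Normc.normc (c k) ^+ 2.
Proof.
move=> KL; apply: complexI; rewrite rmorph_sum rmorphM rmorph_sum /=.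
have e (j : 'I_L) : (Normc.normc (trig_poly c K (unit_root L j)) ^+ 2)%:C =
    \sum_(k < K) \sum_(l < K) c k * Num.conj (c l) *
      (unit_root L j ^+ k * Num.conj (unit_root L j ^+ l)).
  rewrite sqr_normcE /trig_poly rmorph_sum big_distrlr /=.
  apply: eq_bigr => k _; apply: eq_bigr => l _.
  by rewrite rmorphM /= mulrACA.
under eq_bigr do rewrite e.
rewrite exchange_big /= mulr_sumr; apply: eq_bigr => k _.
rewrite exchange_big /= (bigD1 k)//= [X in _ + X]big1 ?addr0.
  rewrite sqr_normcE -mulr_sumr.
  by rewrite (unit_root_orthogonal (widen_ord KL k) (widen_ord KL k)) eqxx muln1
    mulrC rmorph_nat.
move=> l lk.
rewrite -mulr_sumr (unit_root_orthogonal (widen_ord KL k) (widen_ord KL l)).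
have -> : (widen_ord KL k == widen_ord KL l) = (k == l) by [].
by rewrite eq_sym (negbTE lk) muln0 mulr0.
Qed.

Lemma trig_polyS c K z : trig_poly c K.+1 z = trig_poly c K z + c K * z ^+ K.
Proof. by rewrite /trig_poly big_ord_recr. Qed.

(** Summation by parts.  The differences [u ^+ k - u ^+ k.+1] have modulus
    [`|1 - u|], which is how the distance between the two points enters. *)
Lemma trig_poly_abel c K (w u : R[i]) :
  trig_poly c K (w * u) = trig_poly c K w * u ^+ K +
    \sum_(k < K) trig_poly c k.+1 w * (u ^+ k - u ^+ k.+1).
Proof.
elim: K => [|K IH]; first by rewrite /trig_poly !big_ord0 mul0r addr0.
rewrite trig_polyS IH big_ord_recr /= !trig_polyS exprMn exprS; ring.
Qed.

(** With [u = x / w] in [trig_poly_abel], the moduli of the differences are all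
    equal to the distance from [x] to [w]. *)
Lemma trig_poly_near c K (w x : R[i]) :
  Normc.normc w = 1 -> Normc.normc x = 1 ->
  Normc.normc (trig_poly c K x) ^+ 2 <=
  2 * Normc.normc (trig_poly c K w) ^+ 2 +
  2 * Normc.normc (x - w) ^+ 2 *
    (K%:R * \sum_(k < K) Normc.normc (trig_poly c k.+1 w) ^+ 2).
Proof.
move=> w1 x1; set S := fun k => Normc.normc (trig_poly c k.+1 w).
have w0 : w != 0.
  by apply/eqP => w0; move: w1; rewrite w0 Normc.normc0 => /esym/eqP; rewrite oner_eq0.
pose u := x / w.
have u1 : Normc.normc u = 1 by rewrite Normc.normcM Normc.normcV w1 x1 invr1 mulr1.
have d1 : Normc.normc (1 - u) = Normc.normc (x - w).
  rewrite -[RHS]mulr1 -[X in _ * X]invr1 -w1 -Normc.normcV -Normc.normcM.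
  by rewrite mulrBl divff// -normcN opprB.
have le1 : Normc.normc (trig_poly c K x) <=
    Normc.normc (trig_poly c K w) + Normc.normc (x - w) * \sum_(k < K) S k.
  rewrite (_ : x = w * u); last by rewrite /u mulrC divfK.
  rewrite trig_poly_abel; apply: (le_trans (le_normcD _ _)); apply: lerD.
    by rewrite Normc.normcM normcX u1 expr1n mulr1.
  apply: (le_trans (normc_sum _ _)).
  rewrite mulr_sumr; apply: ler_sum => k _.
  rewrite Normc.normcM mulrC exprS -{1}[u ^+ k]mul1r -mulrBl Normc.normcM normcX.
  by rewrite u1 expr1n mulr1 d1 (_ : w * u = x)// /u mulrC divfK.
have S0 : 0 <= \sum_(k < K) S k by apply: sumr_ge0 => k _; exact: normc_ge0.
have le2 := sqr_sum_le K S.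
have a0 := normc_ge0 (trig_poly c K x).
have b0 := normc_ge0 (trig_poly c K w).
have e0 := normc_ge0 (x - w).
move: le1 le2 S0 a0 b0 e0.
set a := Normc.normc (trig_poly c K x); set b := Normc.normc (trig_poly c K w).
set e := Normc.normc (x - w); set s := \sum_(k < K) S k; set q := _ * _.
move=> le1 le2 s0 a0 b0 e0.
apply: (@le_trans _ _ ((b + e * s) ^+ 2)).
  by rewrite ler_sqr ?nnegrE ?addr_ge0 ?mulr_ge0.
apply: (@le_trans _ _ (2 * b ^+ 2 + 2 * e ^+ 2 * s ^+ 2)).
  have := sqr_ge0 (b - e * s); nra.
by rewrite lerD2l ler_wpM2l// mulr_ge0// sqr_ge0.
Qed.

(** Eight points for each mesh length: as [pi < 4], consecutive points are then
    at angle at most [mesh R m] from each other. *)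
Definition grid_size (m : nat) : nat := (8 * 2 ^ m)%N.

Definition near_grid m j (z : circle R) : Prop :=
  `|complex.Re (circle_val z) - complex.Re (unit_root (grid_size m) j)| <= mesh R m /\
  `|complex.Im (circle_val z) - complex.Im (unit_root (grid_size m) j)| <= mesh R m.

(** Round the argument of [z] down to a multiple of the grid angle. *)
Lemma grid_close m (z : circle R) :
  exists2 j, (j < grid_size m)%N & near_grid m j z.
Proof.
have [t /andP[t0 t2] zt] := circle_expi z.
set L := grid_size m.
have L0 : (0 < L)%N by rewrite /L muln_gt0 expn_gt0.
have LR : 0 < L%:R :> R by rewrite ltr0n.
have p0 : 0 < pi *+ 2 :> R by rewrite pmulrn_lgt0// pi_gt0.
pose x := t * L%:R / (pi *+ 2).
have x0 : 0 <= x by rewrite divr_ge0 ?mulr_ge0// ltW.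
exists (Num.truncn x).
  rewrite -(@ltr_nat R); apply: (@le_lt_trans _ _ x).
    by rewrite truncn_le.
  by rewrite ltr_pdivrMr// mulrC ltr_pM2l.
have d : `|t - pi *+ 2 * ((Num.truncn x)%:R / L%:R)| <= mesh R m.
  have -> : t - pi *+ 2 * ((Num.truncn x)%:R / L%:R) =
      (x - (Num.truncn x)%:R) * (pi *+ 2 / L%:R).
    have [pn Ln] : pi *+ 2 != 0 :> R /\ L%:R != 0 :> R by rewrite !gt_eqF.
    rewrite /x mulrBl; congr (_ - _); last by rewrite mulrCA.
    by rewrite mulrA mulfVK// mulfK.
  rewrite normrM (ger0_norm (_ : 0 <= pi *+ 2 / L%:R)); last first.
    by rewrite divr_ge0// ltW.
  apply: (@le_trans _ _ (1 * (pi *+ 2 / L%:R))).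
    rewrite ler_pM2r ?divr_gt0// ler_norml.
    have := truncn_itv x0; rewrite -addn1 natrD => /andP[h1 h2].
    by apply/andP; split; lra.
  rewrite mul1r /L /grid_size natrM invfM mulrA natrX -[leRHS]mul1r.
  rewrite ler_pM2r ?invr_gt0 ?exprn_gt0//.
  by have := pihalf_lt2 R; rewrite ler_pdivrMr// -[pi *+ 2]mulr_natr; lra.
have [d1 d2] := cos_sin_lipschitz t (pi *+ 2 * ((Num.truncn x)%:R / L%:R)).
by rewrite /near_grid zt; split; [exact: le_trans d1 d|exact: le_trans d2 d].
Qed.

(** Large sieve: [M j] bounds the polynomial near the [j]-th root of unity.  By
    [trig_poly_near] it can be taken to be a combination of squared partial sums
    at the root itself, and [parseval] controls the sum over [j].  The factor
    [h ^+ 2] with [h = mesh R m] absorbs the two factors [K], one from the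
    Cauchy-Schwarz inequality and one from the number of partial sums. *)
Lemma sampling_inequality m K c : (K <= 2 ^ m)%N -> exists2 M : nat -> R,
  (forall j, 0 <= M j) /\
  \sum_(j < grid_size m) M j <=
    80 * 2 ^+ m * \sum_(k < K) Normc.normc (c k) ^+ 2 &
  forall j (z : circle R), near_grid m j z ->
    Normc.normc (trig_poly c K (circle_val z)) ^+ 2 <= M j.
Proof.
move=> Km; set L := grid_size m; set h := mesh R m.
have KL : (K <= L)%N by apply: (leq_trans Km); rewrite leq_pmull.
pose S k j := Normc.normc (trig_poly c k (unit_root L j)) ^+ 2.
have S0 k j : 0 <= S k j by rewrite sqr_ge0.
(* Points near the root are at distance at most [2 * h] from it, whence the
   constant 8 in front of [h ^+ 2]. *)
exists (fun j => 2 * S K j + 8 * h ^+ 2 * (K%:R * \sum_(k < K) S k.+1 j)).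
  split=> [j|].
    apply: addr_ge0; first by rewrite mulr_ge0.
    apply: mulr_ge0; first by rewrite mulr_ge0// sqr_ge0.
    by apply: mulr_ge0 => //; apply: sumr_ge0 => k _.
  rewrite big_split /= -mulr_sumr parseval// -mulr_sumr -mulr_sumr exchange_big /=.
  set E := \sum_(k < K) _.
  have E0 : 0 <= E by apply: sumr_ge0 => k _; rewrite sqr_ge0.
  have le1 : \sum_(k < K) \sum_(j < L) S k.+1 j <= K%:R * (L%:R * E).
    rewrite mulr_natl -[K in leRHS]card_ord -sumr_const.
    apply: ler_sum => k _; rewrite parseval; last exact: leq_trans KL.
    rewrite ler_wpM2l//.
    rewrite (big_ord_widen _ (fun k => Normc.normc (c k) ^+ 2) (ltn_ord k)).
    by rewrite big_mkcond /=; apply: ler_sum => i _; case: ifP => // _; exact: sqr_ge0.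
  have h0 : 0 < h := mesh_gt0 R m.
  have hK : h * K%:R <= 1.
    by rewrite /h /mesh mulrC ler_pdivrMr ?exprn_gt0// mul1r -natrX ler_nat.
  have LE : L%:R = 8 * 2 ^+ m :> R by rewrite /L /grid_size natrM natrX.
  have LE0 : 0 <= L%:R * E by rewrite mulr_ge0.
  apply: (@le_trans _ _ (2 * (L%:R * E) + 8 * (L%:R * E))); last first.
    by rewrite LE; lra.
  rewrite lerD2l -mulrA ler_pM2l//.
  apply: (@le_trans _ _ (h ^+ 2 * (K%:R * (K%:R * (L%:R * E))))).
    by rewrite ler_pM2l ?exprn_gt0// ler_wpM2l.
  rewrite (_ : _ * _ = (h * K%:R) ^+ 2 * (L%:R * E)); last by ring.
  by rewrite ler_piMl// exprn_ile1// mulr_ge0// ltW.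
move=> j z [d1 d2].
have z1 := normc_circle_val z.
have w1 : Normc.normc (unit_root L j) = 1 by exact: normc_expi.
apply: (le_trans (trig_poly_near c K w1 z1)).
rewrite -[leRHS]/(2 * S K j + 8 * h ^+ 2 * (K%:R * \sum_(k < K) S k.+1 j)).
rewrite lerD2l ler_wpM2r//.
  by apply: mulr_ge0 => //; apply: sumr_ge0 => k _; exact: sqr_ge0.
have d : Normc.normc (circle_val z - unit_root L j) <= 2 * h.
  apply: (le_trans (normc_le_ReIm _)); rewrite mulr_natl mulr2n !raddfB.
  exact: lerD.
have := normc_ge0 (circle_val z - unit_root L j); rewrite -/(unit_root L j); nra.
Qed.

End sampling.

(** * Cutoff functions and their integrals *)

Section spectral_bound.
Variable R : realType.
Implicit Type c : nat -> R[i].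

Lemma floor_near (x y : R) : `|x - y| <= 1 ->
  exists a : 'I_3, Num.floor x = Num.floor y + a%:Z - 1.
Proof.
rewrite ler_norml => /andP[h1 h2].
have := floor_le x; have := floorD1_gt x; have := floor_le y; have := floorD1_gt y.
rewrite !intrD => y1 y0 x1 x0.
have l1 : Num.floor x < Num.floor y + 2 by rewrite -(ltr_int R) intrD; lra.
have l2 : Num.floor y - 2 < Num.floor x.
  by rewrite -(ltr_int R) intrB; lra.
have a3 : (absz (Num.floor x - Num.floor y + 1)%R < 3)%N by lia.
by exists (Ordinal a3) => /=; lia.
Qed.

(** The nine cells around the one that contains the [j]-th root of unity. *)
Definition grid_cell m j (ab : 'I_3 * 'I_3) : int * int :=
  (Num.floor (2 ^+ m * complex.Re (unit_root R (grid_size m) j)) + ab.1%:Z - 1,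
   Num.floor (2 ^+ m * complex.Im (unit_root R (grid_size m) j)) + ab.2%:Z - 1).

Lemma near_grid_cell m j (z : circle R) : near_grid m j z ->
  exists ab, cell m (grid_cell m j ab) z.
Proof.
have h (x y : R) : `|x - y| <= mesh R m -> `|2 ^+ m * x - 2 ^+ m * y| <= 1.
  rewrite -mulrBr normrM ger0_norm ?exprn_ge0// => le.
  by rewrite -ler_pdivlMl ?exprn_gt0// mulr1.
move=> [/h/floor_near[a e1] /h/floor_near[b e2]]; exists (a, b).
by rewrite /cell /= /cell_index e1 e2.
Qed.

Lemma measurable_fun_borel (f : circle R -> R) : continuous f ->
  measurable_fun setT (f : borel (circle R) -> R).
Proof.
move=> /continuousP cf; apply: (measurability _ (RGenOpens.measurableE R)).
move=> _ [_ [a [b ->] <-]]; rewrite setTI; apply: open_measurable_circle.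
exact/cf/interval_open.
Qed.

Lemma continuous_circleX k : continuous (fun z : circle R => circle_val z ^+ k).
Proof.
elim: k => [|k IH].
  by under eq_fun do rewrite expr0; exact: cst_continuous.
move=> z; under eq_fun do rewrite exprS.
exact: (cvgM (@continuous_circle_val R z) (IH z)).
Qed.

Lemma continuous_trig_poly c K :
  continuous (fun z : circle R => trig_poly c K (circle_val z)).
Proof.
elim: K => [|K IH] z.
  rewrite /trig_poly; under eq_fun do rewrite big_ord0.
  exact: (@cst_continuous _ _ (0 : R[i]) z).
under eq_fun do rewrite trig_polyS.
have cK : continuous (fun _ : circle R => c K) by exact: cst_continuous.
exact: (cvgD (IH z) (cvgM (cK z) (@continuous_circleX K z))).
Qed.

Lemma continuous_conj (g : circle R -> R[i]) : continuous g ->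
  continuous (fun z => Num.conj (g z)).
Proof.
move=> cg z; apply: (continuous_comp (g := @Num.conj R[i]) (cg z)).
apply: (iffRL (@cvgrPdist_le _ _ _ _ (nbhs_filter (g z)) _ _)) => e e0.
apply/nbhs_normP; exists e => // w /= /ltW.
by rewrite -rmorphB norm_conjC.
Qed.

Lemma continuous_sqr_normc (g : circle R -> R[i]) : continuous g ->
  continuous (fun z => Normc.normc (g z) ^+ 2).
Proof.
move=> cg.
have -> : (fun z => Normc.normc (g z) ^+ 2) =
    (fun z => complex.Re (g z) * complex.Re (g z) + complex.Im (g z) * complex.Im (g z)).
  apply/funext => z; case: (g z) => x y /=.
  by rewrite sqr_sqrtr ?addr_ge0 ?sqr_ge0// !expr2.
have cRe : continuous (fun z => complex.Re (g z)).
  by move=> z; apply: (continuous_comp (cg z)); exact: continuous_Re.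
have cIm : continuous (fun z => complex.Im (g z)).
  by move=> z; apply: (continuous_comp (cg z)); exact: continuous_Im.
move=> z.
exact: (cvgD (cvgM (cRe z) (cRe z)) (cvgM (cIm z) (cIm z))).
Qed.

(** Continuous functions times indicators are all the bounded Borel functions
    needed, and for them Borel measurability only uses that preimages of open
    sets are simple; products of general Borel functions are avoided. *)
Definition cutoff (G : set (circle R)) (g : circle R -> R[i]) (z : circle R) : R[i] :=
  if z \in G then g z else 0.

Lemma bounded_borel_cutoff (G : set (borel (circle R))) (g : circle R -> R[i]) (M : R) :
  measurable G -> continuous g -> (forall z, Normc.normc (g z) <= M) ->
  bounded_borel (cutoff G g).
Proof.
move=> mG /continuousP cg gM; split; last first.
  exists (Num.max M 0) => z; rewrite /cutoff le_max; case: ifP => _.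
    by rewrite gM.
  by rewrite Normc.normc0 lexx orbT.
apply: (@measurability _ _ (borel (circle R)) (borel R[i]) setT (cutoff G g)
  (@open R[i]) erefl).
move=> _ [V oV <-]; rewrite setTI.
have -> : cutoff G g @^-1` V = (G `&` g @^-1` V) `|` (~` G `&` [set _ | V 0]).
  apply/seteqP; split => z /=; rewrite /cutoff; have [Gz|Gz] := pselect (G z).
  - by rewrite mem_set// => ?; left.
  - by rewrite memNset// => ?; right.
  - by rewrite mem_set//; move=> [[]|[]].
  - by rewrite memNset//; move=> [[]|[]].
have mV := open_measurable_circle (cg _ oV).
apply: measurableU; first exact: measurableI.
apply: measurableI; first exact: measurableC.
have [V0|V0] := pselect (V 0).
  by rewrite (_ : [set _ | _] = setT)//; apply/seteqP; split.
by rewrite (_ : [set _ | _] = set0)//; apply/seteqP; split.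
Qed.

Lemma trig_poly_bounded c K (z : circle R) :
  Normc.normc (trig_poly c K (circle_val z)) <= \sum_(k < K) Normc.normc (c k).
Proof.
apply: (le_trans (normc_sum _ _)); apply: ler_sum => k _.
by rewrite Normc.normcM normcX normc_circle_val expr1n mulr1.
Qed.

Variable mu : {finite_measure set (borel (circle R)) -> \bar R}.

(** Bound the integrand by the step function which takes the value [M j] on each
    of the nine cells around the [j]-th root of unity; [720 = 9 * 80]. *)
Lemma integral_trig_poly (G : set (borel (circle R))) (mG : measurable G)
    (B : R) m K c : 0 <= B -> (K <= 2 ^ m)%N ->
  (forall j, (mu (G `&` cell m j) <= B%:E)%E) ->
  (\int[mu]_z (Normc.normc (trig_poly c K (circle_val z)) ^+ 2 * \1_G z)%:E <=
   (720 * 2 ^+ m * B * \sum_(k < K) Normc.normc (c k) ^+ 2)%:E)%E.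
Proof.
move=> B0 Km hB; have [M [M0 MS] hM] := sampling_inequality c Km.
set f := fun z : borel (circle R) => Normc.normc (trig_poly c K (circle_val z)) ^+ 2.
pose A (i : 'I_(grid_size m) * ('I_3 * 'I_3)) : set (borel (circle R)) :=
  G `&` cell m (grid_cell m i.1 i.2).
have mA i : measurable (A i) by apply: measurableI => //; exact: measurable_cell.
pose g (i : 'I_(grid_size m) * ('I_3 * 'I_3)) (z : borel (circle R)) : \bar R :=
  ((M i.1)%:E * (\1_(A i) z)%:E)%E.
have mg i : measurable_fun setT (g i).
  by apply: measurable_funeM; apply/measurable_EFinP; exact: measurable_indic.
have g0 i z : [set: borel (circle R)] z -> (0 <= g i z)%E.
  by rewrite /g mule_ge0// lee_fin.
have fg z : ((f z * \1_G z)%:E <= \sum_(i <- index_enum _) g i z)%E.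
  have s0 (P : pred _) : (0 <= \sum_(i | P i) g i z)%E.
    by apply: sume_ge0 => i _; exact: g0.
  rewrite indicE; have [Gz|nGz] := boolP (z \in G); last by rewrite mulr0 s0.
  rewrite mulr1.
  have [j jL jz] := grid_close m z.
  have [ab hab] := near_grid_cell jz.
  pose i0 : 'I_(grid_size m) * ('I_3 * 'I_3) := (Ordinal jL, ab).
  rewrite (bigD1 i0)//=; apply: (@le_trans _ _ (g i0 z)); last by rewrite leeDl.
  rewrite /g indicE (_ : z \in A i0) ?mule1 ?lee_fin.
    exact: hM.
  by apply/mem_set; split => //; exact: set_mem.
apply: (@le_trans _ _ (\int[mu]_z \sum_(i <- index_enum _) g i z)%E).
  apply: ge0_le_integral => //.
  - by move=> z _; rewrite lee_fin mulr_ge0// sqr_ge0.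
  - apply/measurable_EFinP; apply: measurable_funM; last exact: measurable_indic.
    apply: measurable_fun_borel; apply: continuous_sqr_normc.
    exact: continuous_trig_poly.
  - exact: emeasurable_sum.
  - by move=> z _; exact: fg.
rewrite (ge0_integral_sum mu measurableT mg g0).
apply: (@le_trans _ _ (\sum_(i : 'I_(grid_size m) * ('I_3 * 'I_3)) (M i.1 * B)%:E)%E).
  apply: lee_sum => i _; rewrite /g ge0_integralZl//; last 2 first.
  - by apply/measurable_EFinP; exact: measurable_indic.
  - by rewrite lee_fin.
  rewrite integral_indic// setIT EFinM; apply: lee_wpmul2l; first by rewrite lee_fin.
  exact: hB.
rewrite sumEFin lee_fin -mulr_suml.
have -> : \sum_(i : 'I_(grid_size m) * ('I_3 * 'I_3)) M i.1 =
    9 * \sum_(j < grid_size m) M j.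
  rewrite -(pair_bigA _ (fun j _ => M (nat_of_ord j))) /=.
  under eq_bigr do rewrite sumr_const card_prod card_ord.
  by rewrite sumrMnl mulr_natl.
set E := \sum_(k < K) _ in MS *.
have -> : 720 * 2 ^+ m * B * E = 9 * (80 * 2 ^+ m * E) * B by ring.
by rewrite ler_wpM2r// ler_wpM2l.
Qed.

End spectral_bound.

(** * Orthogonal projections on finite sets of basis vectors *)

Section inner_product.
Variables (R : realType) (H : completeNormedModType R[i]).
Variable dot : {dot H for @Num.conj R[i]}.
Implicit Types x y : H.

Definition sqnorm x : R := complex.Re (dot x x).

Lemma dot_sqnorm x : dot x x = (sqnorm x)%:C.
Proof.
have : 0 <= dot x x by exact: dnorm_ge0.
by move/ger0_Im => e; rewrite [LHS]complexE e mulr0 addr0.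
Qed.

Lemma sqnorm_ge0 x : 0 <= sqnorm x.
Proof. by rewrite -lecR -dot_sqnorm; exact: dnorm_ge0. Qed.

Lemma dotC x y : dot y x = Num.conj (dot x y).
Proof. by rewrite hermC /= expr0 mul1r. Qed.

(** The vector [dot y y *: x - dot x y *: y] has nonnegative square norm. *)
Lemma cauchy_schwarz x y :
  Normc.normc (dot x y) ^+ 2 <= sqnorm x * sqnorm y.
Proof.
have [y0|y0] := eqVneq y 0.
  by rewrite y0 linear0r Normc.normc0 expr0n mulr_ge0 ?sqnorm_ge0.
have n0 : 0 < sqnorm y by rewrite -ltcR -dot_sqnorm dnorm_gt0.
set n := sqnorm y; set t := dot x y.
have : 0 <= dot (n%:C *: x - t *: y) (n%:C *: x - t *: y) by exact: dnorm_ge0.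
rewrite dnormB /= !dnormZ linearZl_LR linearZr_LR /= -/t.
rewrite (_ : n%:C * (Num.conj t * t) = (n * Normc.normc t ^+ 2)%:C); last first.
  by rewrite rmorphM /= sqr_normcE [Num.conj t * t]mulrC.
rewrite !dot_sqnorm !normC_normc -!rmorphXn.
rewrite (_ : Num.conj (_%:C) = (n * Normc.normc t ^+ 2)%:C); last first.
  exact: conjc_real.
rewrite -!rmorphM -!rmorphD -rmorphB -/n ler0c.
rewrite (_ : Normc.normc n%:C = n); last first.
  by apply: complexI; rewrite -normC_normc ger0_norm// ler0c ltW.
rewrite (_ : _ + _ - _ = n * (n * sqnorm x - Normc.normc t ^+ 2)); last by ring.
by rewrite pmulr_rge0// subr_ge0 mulrC.
Qed.

Variables (I : choiceType) (A : set I) (phi : I -> H).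
Hypothesis ortho : forall i j, A i -> A j -> dot (phi i) (phi j) = (i == j)%:R.

Definition proj (s : seq I) x : H := \sum_(i <- s) dot x (phi i) *: phi i.

Lemma dot_projl s x y : dot (proj s x) y =
  \sum_(i <- s) dot x (phi i) * Num.conj (dot y (phi i)).
Proof.
rewrite /proj linear_sumlz; apply: eq_bigr => i _.
by rewrite linearZl_LR /= -dotC.
Qed.

Lemma dot_projr s x y : dot x (proj s y) = dot (proj s x) y.
Proof.
rewrite dotC !dot_projl rmorph_sum; apply: eq_bigr => i _.
by rewrite rmorphM /= conjCK mulrC.
Qed.

Lemma proj_fixed s i : uniq s -> {in s, forall j, A j} -> i \in s ->
  proj s (phi i) = phi i.
Proof.
move=> us sA si; rewrite /proj (bigD1_seq i)//= big1_seq ?addr0.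
  by rewrite (ortho (sA _ si) (sA _ si)) eqxx scale1r.
move=> j /andP[ji sj]; rewrite (ortho (sA _ si) (sA _ sj)).
by rewrite eq_sym (negbTE ji) scale0r.
Qed.

Lemma projD s : {morph proj s : u v / u + v}.
Proof.
move=> u v; rewrite /proj -big_split /=; apply: eq_bigr => i _.
by rewrite linearDl scalerDl.
Qed.

Lemma projZ s a u : proj s (a *: u) = a *: proj s u.
Proof.
rewrite /proj scaler_sumr; apply: eq_bigr => i _.
by rewrite linearZl_LR /= scalerA.
Qed.

Lemma proj_lin_span s t (c : I -> R[i]) : uniq s -> {in s, forall j, A j} ->
  {subset t <= s} ->
  proj s (\sum_(i <- t) c i *: phi i) = \sum_(i <- t) c i *: phi i.
Proof.
move=> us sA ts.
have p0 : proj s 0 = 0 by have := projZ s 0 (0 : H); rewrite !scale0r.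
rewrite (big_morph _ (projD s) p0); apply: eq_big_seq => i it.
by rewrite projZ proj_fixed// ts.
Qed.

Definition proj_sqnorm s x : R := \sum_(i <- s) Normc.normc (dot x (phi i)) ^+ 2.

Lemma dot_proj_sqnorm s x : dot (proj s x) x = (proj_sqnorm s x)%:C.
Proof.
rewrite dot_projl /proj_sqnorm rmorph_sum /=; apply: eq_bigr => i _.
by rewrite sqr_normcE.
Qed.

Lemma sqnorm_proj s x : uniq s -> {in s, forall j, A j} ->
  sqnorm (proj s x) = proj_sqnorm s x.
Proof.
move=> us sA; apply: complexI; rewrite -dot_sqnorm -dot_proj_sqnorm.
rewrite dot_projr; congr (dot _ x).
exact: (proj_lin_span (fun i => dot x (phi i)) us sA).
Qed.

Lemma sqnorm_sub_proj s x : uniq s -> {in s, forall j, A j} ->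
  sqnorm (x - proj s x) = sqnorm x - proj_sqnorm s x.
Proof.
move=> us sA; apply: complexI; rewrite -dot_sqnorm dnormB /=.
rewrite !dot_sqnorm sqnorm_proj// dot_projr dot_proj_sqnorm.
rewrite (_ : Num.conj _ = (proj_sqnorm s x)%:C); last exact: conjc_real.
by rewrite -!rmorphD -rmorphB /=; congr (_%:C); ring.
Qed.

(** Split [dot x y] as [dot (proj s x) y + dot x (y - proj s y)]: if [y] is almost
    in the range of the projection, then [proj s x] must be large. *)
Lemma dot_split_proj s x y : uniq s -> {in s, forall j, A j} ->
  Normc.normc (dot x y) ^+ 2 <=
  2 * (proj_sqnorm s x * sqnorm y) +
  2 * (sqnorm x * (sqnorm y - proj_sqnorm s y)).
Proof.
move=> us sA.
have -> : dot x y = dot (proj s x) y + dot x (y - proj s y).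
  by rewrite linearBr /= dot_projr addrCA subrr addr0.
have := le_normcD (dot (proj s x) y) (dot x (y - proj s y)).
have := cauchy_schwarz (proj s x) y; rewrite sqnorm_proj//.
have := cauchy_schwarz x (y - proj s y); rewrite sqnorm_sub_proj//.
have := normc_ge0 (dot (proj s x) y + dot x (y - proj s y)).
have := normc_ge0 (dot (proj s x) y).
have := normc_ge0 (dot x (y - proj s y)).
set a := Normc.normc (dot (proj s x) y); set b := Normc.normc (dot x _).
set e := Normc.normc _ => b0 a0 e0 hb ha le.
apply: (@le_trans _ _ ((a + b) ^+ 2)); first by rewrite ler_sqr ?nnegrE ?addr_ge0.
have := sqr_ge0 (a - b); nra.
Qed.

Hypothesis hnorm : hilbert_norm dot.
Hypothesis dns : dense (lin_span A phi).

(** The projection is the best approximation in its range: a vector of the span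
    within [Num.sqrt e] of [x] is fixed by [proj s] for [s] containing its
    support, and [x - proj s x] is the image of their difference under a
    projection. *)
Lemma proj_approx x (e : R) : 0 < e -> exists s : seq I,
  [/\ uniq s, {in s, forall j, A j} & sqnorm x - e <= proj_sqnorm s x].
Proof.
move=> e0; pose r : R := Num.sqrt e.
have r0 : 0 < r%:C by rewrite ltcR sqrtr_gt0.
have ox : open (ball x r%:C) := ball_open x r%:C.
have nx : ball x r%:C !=set0 by exists x; exact: ballxx.
have [y [xy [t [c [tA ye]]]]] := dns nx ox.
exists (undup t); have uA : {in undup t, forall j, A j}.
  by move=> j; rewrite mem_undup; exact: tA.
split => //; first exact: undup_uniq.
rewrite lerBlDr -lerBlDl -sqnorm_sub_proj ?undup_uniq//.
have py : proj (undup t) y = y.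
  by rewrite ye proj_lin_span ?undup_uniq// => j; rewrite mem_undup.
have -> : x - proj (undup t) x = (x - y) - proj (undup t) (x - y).
  have -> : proj (undup t) (x - y) = proj (undup t) x - y.
    by rewrite projD -(scaleN1r y) projZ py.
  by rewrite opprB addrA subrK.
rewrite sqnorm_sub_proj ?undup_uniq//.
apply: (@le_trans _ _ (sqnorm (x - y))).
  rewrite lerBlDr lerDl; apply: sumr_ge0 => i _; exact: sqr_ge0.
rewrite -lecR -dot_sqnorm -hnorm -(sqr_sqrtr (ltW e0)) rmorphXn /=.
move: xy; rewrite -ball_normE /= => /ltW; rewrite -/r => le.
by rewrite ler_pXn2r ?nnegrE// ltW.
Qed.

Lemma parseval_ge x : ((sqnorm x)%:E <=
  \esum_(i in A) (Normc.normc (dot x (phi i)) ^+ 2)%:E)%E.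
Proof.
apply/lee_subgt0Pr => e e0; have [s [us sA h]] := proj_approx x e0.
apply: esum_ge; exists [set` s]; first by split; [exact: finite_seq|].
rewrite -fsbig_seq// sumEFin -EFinB lee_fin; exact: h.
Qed.

End inner_product.

(** * The Strichartz estimate for a cutoff state *)

Section spectral_projection.
Variables (R : realType) (H : completeNormedModType R[i]).
Variable dot : {dot H for @Num.conj R[i]}.
Variables (U : {linear H -> H}) (psi : H).
Variable mu : {finite_measure set (borel (circle R)) -> \bar R}.
Variable Phi : (circle R -> R[i]) -> {linear H -> H}.
Hypothesis calc : borel_calculus dot U Phi.
Hypothesis spec : forall f, bounded_borel f ->
  dot (Phi f psi) psi = complex_integral mu f.

(** By the adjoint and product rules, [`|f(U) psi|^2 = <psi, `|f|^2(U) psi>]. *)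
Lemma sqnorm_calculus (G : set (borel (circle R))) (g : circle R -> R[i]) (M : R) :
  measurable G -> continuous g -> (forall z, Normc.normc (g z) <= M) ->
  sqnorm dot (Phi (cutoff G g) psi) =
  fine (\int[mu]_z (Normc.normc (g z) ^+ 2 * \1_G z)%:E).
Proof.
move=> mG cg gM.
have bf := bounded_borel_cutoff mG cg gM.
have gM' z : Normc.normc (Num.conj (g z)) <= M.
  suff -> : Normc.normc (Num.conj (g z)) = Normc.normc (g z) by [].
  by apply: complexI; rewrite -!normC_normc norm_conjC.
have bcf := bounded_borel_cutoff mG (continuous_conj cg) gM'.
have cutoffC : (fun z => Num.conj (cutoff G g z)) = cutoff G (fun z => Num.conj (g z)).
  by apply/funext => z; rewrite /cutoff; case: ifP => // _; rewrite rmorph0.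
have cgg : continuous (fun z => Num.conj (g z) * g z).
  by move=> z; exact: (cvgM (continuous_conj cg (x := z)) (cg z)).
have ggM z : Normc.normc (Num.conj (g z) * g z) <= M * M.
  by rewrite Normc.normcM; apply: ler_pM => //; exact: normc_ge0.
have bff := bounded_borel_cutoff mG cgg ggM.
have cutoffM : (fun z => cutoff G (fun z => Num.conj (g z)) z * cutoff G g z) =
    cutoff G (fun z => Num.conj (g z) * g z).
  by apply/funext => z; rewrite /cutoff; case: ifP => // _; rewrite mulr0.
apply: complexI; rewrite -dot_sqnorm -(calculus_adj calc _ _ bf) cutoffC.
rewrite -(calculusM calc _ bcf bf) cutoffM spec// /complex_integral /Rintegral.
have e z : cutoff G (fun z => Num.conj (g z) * g z) z =
    (Normc.normc (g z) ^+ 2 * \1_G z)%:C.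
  rewrite indicE rmorphM rmorph_nat /= sqr_normcE /cutoff.
  by case: (z \in G); rewrite ?mulr1 ?mulr0 // mulrC.
under eq_integral do rewrite e.
congr (_ +i* _).
by under eq_integral do rewrite e; rewrite integral0.
Qed.

Lemma bounded_borel_id : bounded_borel (@circle_val R).
Proof.
have -> : @circle_val R = cutoff setT (@circle_val R).
  by apply/funext => z; rewrite /cutoff mem_set.
apply: (@bounded_borel_cutoff _ _ _ 1) => //; first exact: continuous_circle_val.
by move=> z; rewrite normc_circle_val.
Qed.

Variable G : set (borel (circle R)).
Hypothesis mG : measurable G.

(** The component of [psi] in the spectral subspace of [G]; its spectral measure
    is the restriction of [mu] to [G]. *)
Definition psi_on : H := Phi (cutoff G (fun=> 1)) psi.

Lemma bounded_borel_cutoff1 : bounded_borel (cutoff G (fun=> 1)).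
Proof.
apply: (@bounded_borel_cutoff _ _ _ 1) => //; first exact: cst_continuous.
by move=> z; rewrite Normc.normc1.
Qed.

Lemma bounded_borel_cutoffX k : bounded_borel (cutoff G (fun z => circle_val z ^+ k)).
Proof.
apply: (@bounded_borel_cutoff _ _ _ 1) => //; first exact: continuous_circleX.
by move=> z; rewrite normcX normc_circle_val expr1n.
Qed.

Lemma calculus_cutoffX k :
  Phi (cutoff G (fun z => circle_val z ^+ k)) psi = iter k U psi_on.
Proof.
elim: k => [|k IH]; first by under eq_fun do rewrite expr0.
rewrite iterS -IH -(calculus_id calc).
rewrite -(calculusM calc _ bounded_borel_id (bounded_borel_cutoffX k)).
congr (Phi _ psi); apply/funext => z; rewrite /cutoff exprS.
by case: ifP => // _; rewrite mulr0.
Qed.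

Lemma bounded_borel_cutoff_trig_poly c K :
  bounded_borel (cutoff G (fun z => trig_poly c K (circle_val z))).
Proof.
apply: bounded_borel_cutoff => //; first exact: continuous_trig_poly.
by move=> z; exact: trig_poly_bounded.
Qed.

Lemma calculus_cutoff_trig_poly c K :
  Phi (cutoff G (fun z => trig_poly c K (circle_val z))) psi =
  \sum_(k < K) c k *: iter k U psi_on.
Proof.
elim: K => [|K IH].
  rewrite big_ord0 -(scale0r psi_on) -(calculusZ calc _ _ bounded_borel_cutoff1).
  congr (Phi _ psi); apply/funext => z.
  by rewrite /cutoff /trig_poly big_ord0 mul0r; case: ifP.
have bZ : bounded_borel (fun z => c K * cutoff G (fun z => circle_val z ^+ K) z).
  have -> : (fun z => c K * cutoff G (fun z => circle_val z ^+ K) z) =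
      cutoff G (fun z => c K * circle_val z ^+ K).
    by apply/funext => z; rewrite /cutoff; case: ifP => // _; rewrite mulr0.
  apply: (@bounded_borel_cutoff _ _ _ (Normc.normc (c K))) => //.
    have cK : continuous (fun _ : circle R => c K) by exact: cst_continuous.
    by move=> z; exact: (cvgM (cK z) (@continuous_circleX _ K z)).
  by move=> z; rewrite Normc.normcM normcX normc_circle_val expr1n mulr1.
rewrite big_ord_recr /= -IH -calculus_cutoffX.
rewrite -(calculusZ calc _ _ (bounded_borel_cutoffX K)).
rewrite -(calculusD calc _ (bounded_borel_cutoff_trig_poly c K) bZ).
congr (Phi _ psi); apply/funext => z; rewrite /cutoff trig_polyS.
by case: ifP => // _; rewrite mulr0 addr0.
Qed.

Lemma sqnorm_psi_on : sqnorm dot psi_on = fine (mu G).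
Proof.
rewrite /psi_on (@sqnorm_calculus _ _ 1)//; last 2 first.
- exact: cst_continuous.
- by move=> z; rewrite Normc.normc1.
under eq_integral do rewrite Normc.normc1 expr1n mul1r.
by rewrite integral_indic// setIT.
Qed.

Lemma dot_psi_on : dot psi_on psi = (fine (mu G))%:C.
Proof.
rewrite spec; last exact: bounded_borel_cutoff1.
have e z : cutoff G (fun=> 1) z = (\1_G z)%:C :> R[i].
  by rewrite /cutoff indicE; case: (z \in G).
rewrite /complex_integral /Rintegral; congr (_ +i* _).
  by under eq_integral do rewrite e; rewrite /= integral_indic// setIT.
by under eq_integral do rewrite e; rewrite integral0.
Qed.

Variables (B : R) (m : nat).
Hypothesis B0 : 0 <= B.
Hypothesis hB : forall j, (mu (G `&` cell m j) <= B%:E)%E.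

Lemma sqnorm_trig_sum (c : nat -> R[i]) K : (K <= 2 ^ m)%N ->
  sqnorm dot (\sum_(k < K) c k *: iter k U psi_on) <=
  720 * 2 ^+ m * B * \sum_(k < K) Normc.normc (c k) ^+ 2.
Proof.
move=> Km; rewrite -calculus_cutoff_trig_poly.
rewrite (@sqnorm_calculus _ _ (\sum_(k < K) Normc.normc (c k)))//; last 2 first.
- exact: continuous_trig_poly.
- by move=> z; exact: trig_poly_bounded.
have := integral_trig_poly mG c B0 Km hB.
set J := integral _ _ _.
have J0 : (0 <= J)%E.
  by apply: integral_ge0 => z _; rewrite lee_fin mulr_ge0// sqr_ge0.
move=> le; have Jfin : J \is a fin_num.
  by rewrite ge0_fin_numE//; apply: le_lt_trans le _; exact: ltry.
by rewrite -lee_fin fineK.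
Qed.

(** Dual form of [sqnorm_trig_sum]: testing it against the coefficients
    [<U^k psi_on, f>] themselves, the Cauchy-Schwarz inequality gives
    [S ^+ 2 <= sqnorm v * sqnorm f <= C * S * sqnorm f] for the sum [S] to be
    bounded. *)
Lemma strichartz K (f : H) : (K <= 2 ^ m)%N ->
  \sum_(k < K) Normc.normc (dot (iter k U psi_on) f) ^+ 2 <=
  720 * 2 ^+ m * B * sqnorm dot f.
Proof.
move=> Km; set S := (X in X <= _).
pose c k := Num.conj (dot (iter k U psi_on) f).
have S0 : 0 <= S by apply: sumr_ge0 => k _; exact: sqr_ge0.
set v := \sum_(k < K) c k *: iter k U psi_on.
have dvf : dot v f = S%:C.
  rewrite /v linear_sumlz rmorph_sum; apply: eq_bigr => k _.
  by rewrite linearZl_LR /= sqr_normcE mulrC.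
have vS : sqnorm dot v <= 720 * 2 ^+ m * B * S.
  apply: (le_trans (sqnorm_trig_sum c Km)).
  rewrite le_eqVlt; apply/orP; left; apply/eqP; congr (_ * _).
  apply: eq_bigr => k _; congr (_ ^+ 2).
  by apply: complexI; rewrite -!normC_normc norm_conjC.
have := cauchy_schwarz dot v f; rewrite dvf.
have -> : Normc.normc S%:C = S.
  by apply: complexI; rewrite -normC_normc ger0_norm// ler0c.
have f0 := sqnorm_ge0 dot f.
have C0 : 0 <= 720 * 2 ^+ m * B.
  by apply: mulr_ge0 B0; apply: mulr_ge0 (exprn_ge0 _ _); exact: ler0n.
move: (720 * 2 ^+ m * B) C0 vS => C C0 vS h.
have [->|Sn] := eqVneq S 0; first exact: mulr_ge0.
have Sp : 0 < S by rewrite lt_def Sn.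
rewrite -(ler_pM2l Sp) -expr2; apply: (le_trans h).
rewrite mulrCA mulrA; apply: ler_wpM2r => //.
Qed.

End spectral_projection.

(** * Moments and mass outside a box *)

Section lattice_box.
Variables (d : nat) (A : set {ffun 'I_d -> int}).

(** Lattice points of [A] with all coordinates at most [N] in absolute value: a
    cube, easier to count than the ball of [lattice_norm] and containing it. *)
Definition box (N : nat) : seq {ffun 'I_d -> int} :=
  undup [seq n <- [seq [ffun i => (nat_of_ord (g i))%:Z - N%:Z]
    | g : {ffun 'I_d -> 'I_(N.*2.+1)}] | `[< A n >]].

Lemma size_box N : (size (box N) <= N.*2.+1 ^ d)%N.
Proof.
apply: (leq_trans (size_undup _)); rewrite size_filter.
apply: (leq_trans (count_size _ _)).
by rewrite size_map -cardE card_ffun !card_ord.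
Qed.

Lemma box_uniq N : uniq (box N).
Proof. exact: undup_uniq. Qed.

Lemma box_sub N : {in box N, forall n, A n}.
Proof. by move=> n; rewrite mem_undup mem_filter => /andP[/asboolP]. Qed.

Lemma lattice_norm_gt_box N n : A n -> n \notin box N -> (N < lattice_norm n)%N.
Proof.
move=> An; apply: contraNltn => nN.
rewrite mem_undup mem_filter asboolT//=.
have le i : (`|n i| <= N)%N.
  by apply: leq_trans nN; rewrite /lattice_norm (bigD1 i)//= leq_addr.
have lt i : (`|(n i + N%:Z)%R| < N.*2.+1)%N by have := le i; lia.
apply/mapP; exists [ffun i => Ordinal (lt i)]; first by rewrite mem_enum.
by apply/ffunP => i; rewrite !ffunE /=; have := le i; lia.
Qed.

End lattice_box.

Section averaged_moment_bound.
Variables (R : realType) (H : completeNormedModType R[i]).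
Variable dot : {dot H for @Num.conj R[i]}.
Hypothesis hH : hilbert_norm dot.
Variables (U : {linear H -> H}) (psi : H).
Hypothesis isoU : isometry dot dot U.
Hypothesis psi1 : `|psi| = 1.
Variables (d : nat) (A : set {ffun 'I_d -> int}).
Variable phi : {ffun 'I_d -> int} -> H.
Hypothesis basis : orthonormal_basis dot A phi.

Lemma iter_isometry k x y : dot (iter k U x) (iter k U y) = dot x y.
Proof. by elim: k => // k IH; rewrite !iterS isoU. Qed.

Lemma sqnorm_iter k x : sqnorm dot (iter k U x) = sqnorm dot x.
Proof. by rewrite /sqnorm iter_isometry. Qed.

Lemma sqnorm_psi : sqnorm dot psi = 1.
Proof. by apply: complexI; rewrite -dot_sqnorm -hH psi1 expr1n. Qed.

Lemma moment_ge1 p k : (1 <= moment dot U psi A phi p k)%E.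
Proof.
rewrite -[1%E]/((1 : R)%:E) -sqnorm_psi -(sqnorm_iter k).
apply: (le_trans (parseval_ge basis.1 hH basis.2 _)).
apply: le_esum => n _; rewrite lee_fin /amplitude ler_peMl ?sqr_ge0//.
by rewrite lerDr powR_ge0.
Qed.

Lemma averaged_moment_ge_sum p K (x : R) : (0 < K)%N ->
  ((K%:R * x)%:E <= \sum_(0 <= k < K) moment dot U psi A phi p k)%E ->
  (x%:E <= averaged_moment dot U psi A phi p K)%E.
Proof.
move=> K0 le; have KR : 0 < K%:R :> R by rewrite ltr0n.
have -> : x = K%:R^-1 * (K%:R * x) by rewrite mulKf ?gt_eqF.
by rewrite EFinM; apply: lee_wpmul2l => //; rewrite lee_fin invr_ge0 ltW.
Qed.

Lemma averaged_moment_ge1 p K : (0 < K)%N ->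
  (1 <= averaged_moment dot U psi A phi p K)%E.
Proof.
move=> K0; apply: averaged_moment_ge_sum => //.
have -> : (K%:R * 1)%:E = (\sum_(0 <= k < K) 1)%E :> \bar R.
  by rewrite sumEFin mulr1 big_const_nat subn0 iter_addr_0.
by apply: lee_sum => k _; exact: moment_ge1.
Qed.

Variables (p : R) (N : nat).
Hypothesis p0 : 0 < p.

Definition tail_mass k : R := 1 - proj_sqnorm dot phi (box A N) (iter k U psi).

(** Outside the box the weight of the moment is at least [N `^ p].  The error [e]
    allows the use of finitely many basis vectors only. *)
Lemma moment_ge_tail k (e : R) : 0 < e ->
  ((N%:R `^ p * (tail_mass k - e))%:E <= moment dot U psi A phi p k)%E.
Proof.
move=> e0; have [s [us sA h]] := proj_approx basis.1 hH basis.2 (iter k U psi) e0.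
apply: esum_ge; exists [set` s]; first by split; [exact: finite_seq|].
rewrite -fsbig_seq// sumEFin lee_fin.
have N1 : 0 <= N%:R `^ p :> R by exact: powR_ge0.
pose a n := amplitude dot U psi phi n k.
have a0 n : 0 <= a n by exact: sqr_ge0.
apply: (@le_trans _ _ (\sum_(n <- s | n \notin box A N) N%:R `^ p * a n)).
  rewrite -mulr_sumr ler_wpM2l//.
  move: h; rewrite sqnorm_iter sqnorm_psi /proj_sqnorm -/(a _) => h.
  have h2 : \sum_(n <- s | n \in box A N) a n <=
      proj_sqnorm dot phi (box A N) (iter k U psi).
    rewrite -big_filter /proj_sqnorm.
    rewrite [leRHS](bigID (mem s)) /= -[X in X <= _]addr0; apply: lerD.
      rewrite -[leRHS]big_filter le_eqVlt; apply/orP; left; apply/eqP.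
      apply: perm_big; apply: uniq_perm; rewrite ?filter_uniq ?box_uniq//.
      by move=> n; rewrite !mem_filter andbC.
    by apply: sumr_ge0 => n _; exact: sqr_ge0.
  rewrite lerBlDr -lerBlDl; rewrite (bigID (mem (box A N))) /= in h.
  rewrite /tail_mass; move: h h2; rewrite -/(a _).
  set X := \sum_(n <- s | n \in box A N) _.
  by set Y := \sum_(n <- s | n \notin box A N) _; lra.
rewrite [leRHS](bigID (mem (box A N))) /= -[X in X <= _]add0r; apply: lerD.
  by apply: sumr_ge0 => n _; apply: mulr_ge0 (a0 n); rewrite addr_ge0 ?powR_ge0.
rewrite !(big_seq_cond (fun n => n \notin _)).
apply: ler_sum => n /andP[ns nN]; rewrite ler_wpM2r//.
apply: (@le_trans _ _ ((lattice_norm n)%:R `^ p)); last by rewrite lerDl.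
apply: ge0_ler_powR; rewrite ?nnegrE ?(ltW p0)// ler_nat ltnW//.
by apply: (@lattice_norm_gt_box _ A) => //; exact: sA.
Qed.

Variable mu : {finite_measure set (borel (circle R)) -> \bar R}.
Variable Phi : (circle R -> R[i]) -> {linear H -> H}.
Hypothesis calc : borel_calculus dot U Phi.
Hypothesis spec : forall f, bounded_borel f ->
  dot (Phi f psi) psi = complex_integral mu f.
Variable G : set (borel (circle R)).
Hypothesis mG : measurable G.
Variables (B : R) (m K : nat).
Hypothesis B0 : 0 <= B.
Hypothesis hB : forall j, (mu (G `&` cell m j) <= B%:E)%E.
Hypotheses (K0 : (0 < K)%N) (Km : (K <= 2 ^ m)%N).

Let s : R := fine (mu G).
Hypothesis s0 : 0 < s.
Hypothesis small :
  4 * (size (box A N))%:R * (720 * 2 ^+ m * B) <= K%:R * s ^+ 2.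

Lemma sum_proj_sqnorm_psi_on :
  \sum_(k < K) proj_sqnorm dot phi (box A N) (iter k U (psi_on psi Phi G)) <=
  (size (box A N))%:R * (720 * 2 ^+ m * B).
Proof.
rewrite exchange_big /= big_seq.
apply: (@le_trans _ _ (\sum_(n <- box A N | n \in box A N) (720 * 2 ^+ m * B))).
  apply: ler_sum => n nb.
  apply: (le_trans (strichartz calc spec mG B0 hB (phi n) Km)).
  have -> : sqnorm dot (phi n) = 1.
    by apply: complexI; rewrite -dot_sqnorm basis.1 ?eqxx//; exact: box_sub nb.
  by rewrite mulr1.
by rewrite -big_seq big_const_seq count_predT iter_addr_0 -[leLHS]mulr_natl.
Qed.

(** Apply [dot_split_proj] to [U^k psi_on] and [U^k psi], whose inner product is
    [s] for every [k], and average over [k]: at least half of [s ^+ 2] comes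
    from the tail, and the error [e = s / 8] of [moment_ge_tail] is affordable. *)
Lemma averaged_moment_ge :
  ((N%:R `^ p * (s / 8))%:E <= averaged_moment dot U psi A phi p K)%E.
Proof.
have KR : 0 < K%:R :> R by rewrite ltr0n.
apply: averaged_moment_ge_sum => //.
apply: (@le_trans _ _
    (\sum_(0 <= k < K) (N%:R `^ p * (tail_mass k - s / 8))%:E)%E); last first.
  by apply: lee_sum => k _; apply: moment_ge_tail; rewrite divr_gt0.
rewrite sumEFin lee_fin -mulr_sumr mulrCA ler_wpM2l ?powR_ge0//.
rewrite big_mkord sumrB sumr_const card_ord -mulr_natl.
have key (k : nat) : s ^+ 2 <=
    2 * proj_sqnorm dot phi (box A N) (iter k U (psi_on psi Phi G)) +
    2 * (s * tail_mass k).
  have := dot_split_proj basis.1 (iter k U (psi_on psi Phi G)) (iter k U psi)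
    (box_uniq A N) (@box_sub _ A N).
  rewrite iter_isometry (dot_psi_on spec mG) !sqnorm_iter sqnorm_psi.
  rewrite (sqnorm_psi_on calc spec mG) mulr1 -/s.
  rewrite (_ : Normc.normc s%:C = s)//.
  by apply: complexI; rewrite -normC_normc ger0_norm// ler0c ltW.
have : \sum_(k < K) s ^+ 2 <= \sum_(k < K)
   (2 * proj_sqnorm dot phi (box A N) (iter k U (psi_on psi Phi G)) +
    2 * (s * tail_mass k)).
  by apply: ler_sum => k _; exact: key.
rewrite sumr_const card_ord -mulr_natl big_split /= -!mulr_sumr.
have := sum_proj_sqnorm_psi_on.
set P := \sum_(k < K) proj_sqnorm _ _ _ _; set Q := \sum_(k < K) tail_mass k.
move: small; set Z := 720 * 2 ^+ m * B => sm hP hQ.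
have : s * (K%:R * (s / 4)) <= s * Q.
  have -> : s * (K%:R * (s / 4)) = K%:R * s ^+ 2 / 4 by field.
  move: sm hP; rewrite -[4 * _ * Z]mulrA.
  move: (_ * Z) (s * Q) hQ => W V hQ sm hP. lra.
rewrite ler_pM2l//; lra.
Qed.

End averaged_moment_bound.

(** * Growth of the averaged moments *)

Section asymptotics.
Variable R : realType.

Lemma limn_einf_ge (u : (\bar R)^nat) (a : \bar R) (n0 : nat) :
  (forall n, (n0 <= n)%N -> (a <= u n)%E) -> (a <= limn_einf u)%E.
Proof.
move=> h; rewrite /limn_einf leeNr; apply: ge_ereal_inf.
exists (ereal_sup ((fun n => - u n)%E @` [set n | (n0 <= n)%N])).
  by exists [set n | (n0 <= n)%N] => //; exists n0.
by apply: ge_ereal_sup => _ [n /= nn <-]; rewrite leeN2; exact: h.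
Qed.

Lemma ln_large (X : R) : exists K0, forall K, (K0 <= K)%N -> X <= ln K%:R.
Proof.
exists (Num.bound (expR X)) => K K0.
have le : expR X <= K%:R.
  apply: (le_trans (ltW (archi_boundP (expR_ge0 X)))); by rewrite ler_nat.
rewrite -{1}(expRK X) ler_ln ?posrE ?expR_gt0//.
by apply: lt_le_trans le; exact: expR_gt0.
Qed.

Lemma dyadic_scale (K : nat) : (0 < K)%N ->
  exists m, (K <= 2 ^ m)%N /\ (2 ^ m <= 2 * K)%N.
Proof.
move=> K0; exists (up_log 2 K); split; first exact: up_logP.
case: K K0 => [//|[|K]] _; first by rewrite up_log1.
have := @up_log_gtn 2 K.+2 isT isT.
have : (0 < up_log 2 K.+2)%N by rewrite up_log_gt0.
by case: (up_log _ _) => // n _ /=; rewrite expnS => /ltnW; rewrite leq_pmul2l.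
Qed.

(** The multiplicative constant [c] contributes [ln c / (p * ln K)], which tends
    to zero. *)
Lemma log_ratio_ge (c e p x : R) : 0 < c -> 0 < e -> 0 < p ->
  exists K0, forall (K : nat) (y : \bar R), (K0 <= K)%N ->
    ((c * K%:R `^ (p * x))%:E <= y)%E ->
    ((x - e)%:E <= lne y / (p * ln K%:R)%:E)%E.
Proof.
move=> c0 e0 p0; pose X := Num.max 1 (- ln c / (e * p)).
have [K0 hK] := ln_large X; exists K0.+1 => K y K1 le.
have X1 : X <= ln K%:R by apply: hK; exact: ltnW.
have KR : 0 < K%:R :> R by rewrite ltr0n (leq_trans _ K1).
have l0 : 0 < ln K%:R :> R.
  by apply: lt_le_trans X1; rewrite lt_max ltr01.
have pl : 0 < p * ln K%:R by rewrite mulr_gt0.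
have lc : - ln c <= e * (p * ln K%:R).
  have : - ln c / (e * p) <= ln K%:R by apply: le_trans X1; rewrite le_max lexx orbT.
  by rewrite ler_pdivrMr ?mulr_gt0// => h; apply: (le_trans h); rewrite mulrC mulrA.
have ck0 : 0 < c * K%:R `^ (p * x) by rewrite mulr_gt0// powR_gt0.
have : ((ln (c * K%:R `^ (p * x)))%:E <= lne y)%E.
  rewrite -lne_EFin// lee_lne// in_itv/= ?leey ?andbT//; first by rewrite lee_fin ltW.
  by apply: le_trans le; rewrite lee_fin ltW.
rewrite inver gt_eqF// lee_pdivlMr//; apply: le_trans.
rewrite -EFinM lee_fin lnM ?posrE ?powR_gt0// ln_powR.
by move: lc; rewrite -lerBlDr; lra.
Qed.

(** [N] is the integer part of [(c * K `^ alpha) `^ d^-1], at least half of that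
    number as soon as it is at least 1. *)
Lemma box_radius (alpha c : R) (d : nat) : 0 < alpha -> (0 < d)%N -> 0 < c ->
  exists2 c', 0 < c' & exists K0, forall K, (K0 <= K)%N ->
    exists N : nat, [/\ (0 < N)%N, (N%:R ^+ d <= c * K%:R `^ alpha :> R) &
      c' * K%:R `^ (alpha / d%:R) <= N%:R].
Proof.
move=> a0 d0 c0.
have dR : 0 < d%:R :> R by rewrite ltr0n.
pose c1 := c `^ (d%:R^-1).
have c10 : 0 < c1 by exact: powR_gt0.
exists (c1 / 2); first by rewrite divr_gt0.
have b0 : 0 < alpha / d%:R by rewrite divr_gt0.
have [K0 hK] := ln_large (ln (c1^-1) / (alpha / d%:R)).
exists K0.+1 => K K1.
have KR : 0 < K%:R :> R by rewrite ltr0n (leq_trans _ K1).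
pose x := c1 * K%:R `^ (alpha / d%:R).
have x1 : 1 <= x.
  rewrite /x -ler_pdivrMl// mulr1 -ler_ln ?posrE ?invr_gt0 ?powR_gt0// ln_powR.
  by rewrite mulrC -ler_pdivrMr//; apply: hK; exact: ltnW.
have x0 : 0 <= x by exact: le_trans x1.
exists (Num.truncn x); split.
- by rewrite truncn_gt0.
- apply: (@le_trans _ _ (x ^+ d)).
    by rewrite lerXn2r ?nnegrE// truncn_le.
  rewrite -powR_mulrn// /x powRM ?powR_ge0//.
  by rewrite /c1 -!powRrM mulVf ?gt_eqF// divfK ?gt_eqF// powRr1// ltW.
have := truncn_itv x0; rewrite -addn1 natrD => /andP[_ xt].
have t1 : 1 <= (Num.truncn x)%:R :> R by rewrite ler1n truncn_gt0.
by rewrite mulrAC -/x; lra.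
Qed.

End asymptotics.

Section lower_bound.
Variables (R : realType) (H : completeNormedModType R[i]).
Variable dot : {dot H for @Num.conj R[i]}.
Hypothesis hH : hilbert_norm dot.
Variables (U : {linear H -> H}) (psi : H).
Hypothesis isoU : isometry dot dot U.
Hypothesis psi1 : `|psi| = 1.
Variables (d : nat) (A : set {ffun 'I_d -> int}).
Hypothesis d0 : (0 < d)%N.
Variable phi : {ffun 'I_d -> int} -> H.
Hypothesis basis : orthonormal_basis dot A phi.
Variable mu : {finite_measure set (borel (circle R)) -> \bar R}.
Hypothesis hmu : spectral_measure dot U psi mu.
Variable p : R.
Hypothesis p0 : 0 < p.

(** Every moment is at least [`|psi|^2 = 1]. *)
Lemma lower_transport_exponent_ge0 :
  (0 <= lower_transport_exponent dot U psi A phi p)%E.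
Proof.
apply: (@limn_einf_ge _ _ _ 2) => K K2.
have pl : 0 < p * ln K%:R by rewrite mulr_gt0// ln_gt0// ltr1n.
rewrite inver gt_eqF// lee_pdivlMr// mul0e lne_ge0.
by apply: averaged_moment_ge1 => //; exact: leq_trans K2.
Qed.

Lemma averaged_moment_power (alpha : R) : 0 < alpha ->
  (alpha%:E < upper_hausdorff_dim mu)%E ->
  exists2 c, 0 < c & exists K0, forall K, (K0 <= K)%N ->
    ((c * K%:R `^ (p * (alpha / d%:R)))%:E <= averaged_moment dot U psi A phi p K)%E.
Proof.
move=> a0 /(frostman a0)[F muG].
have [Phi calc spec] := hmu.
set G : set (borel (circle R)) := good_points mu alpha F in muG.
have mG : measurable G := measurable_good_points mu alpha F.
pose s := fine (mu G).
have s0 : 0 < s by rewrite fine_gt0// muG -ge0_fin_numE ?fin_num_measure.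
(* [D * N ^+ d * K `^ (1 - alpha)] bounds the left-hand side of the smallness
   condition of [averaged_moment_ge], because [K <= 2 ^ m <= 2 * K] and the box
   has at most [(3 * N) ^+ d] points. *)
pose D : R := 4 * 3 ^+ d * (1440 * F.+1%:R).
have D0 : 0 < D.
  have h3 : 0 < 3 ^+ d :> R by rewrite exprn_gt0// ltr0n.
  have h4 : 0 < 4 :> R by rewrite ltr0n.
  have h1440 : 0 < 1440 :> R by rewrite ltr0n.
  exact: mulr_gt0 (mulr_gt0 h4 h3) (mulr_gt0 h1440 (ltr0Sn _ F)).
have cD : 0 < s ^+ 2 / D by rewrite divr_gt0// exprn_gt0.
have [c' c'0 [K0 hK]] := box_radius a0 d0 cD.
exists ((s / 8) * c' `^ p).
  by rewrite mulr_gt0 ?divr_gt0// powR_gt0.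
exists K0.+1 => K K1.
have Kpos : (0 < K)%N by exact: leq_trans K1.
have KR : 0 < K%:R :> R by rewrite ltr0n.
have [N [N0 Nd Nc]] := hK K (ltnW K1).
have [m [Km mK]] := dyadic_scale Kpos.
pose B : R := F%:R * mesh R m `^ alpha.
have B0 : 0 <= B by rewrite mulr_ge0// powR_ge0.
have hB j : (mu (G `&` cell m j) <= B%:E)%E by exact: good_points_cell.
have bN : (size (box A N))%:R <= 3 ^+ d * N%:R ^+ d :> R.
  rewrite -exprMn -natrM -natrX ler_nat; apply: (leq_trans (size_box A N)).
  by rewrite leq_exp2r//; lia.
have ka0 : 0 < K%:R `^ alpha :> R by rewrite powR_gt0.
have K2 : 720 * 2 ^+ m * B <= 1440 * F.+1%:R * (K%:R / K%:R `^ alpha).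
  have h1 : 2 ^+ m <= 2 * K%:R :> R by rewrite -natrX -natrM ler_nat.
  have h2 : mesh R m `^ alpha <= (K%:R `^ alpha)^-1.
    rewrite -[leRHS]mul1r ler_pdivlMr// -powRM ?ler0n ?(ltW (mesh_gt0 _ _))//.
    apply: (@le_trans _ _ (1 `^ alpha)); last by rewrite powR1.
    apply: ge0_ler_powR; rewrite ?nnegrE ?(ltW a0)//.
      by rewrite mulr_ge0 ?ler0n ?(ltW (mesh_gt0 _ _)).
    by rewrite /mesh mulrC ler_pdivrMr ?exprn_gt0// mul1r -natrX ler_nat.
  have h3 : F%:R <= F.+1%:R :> R by rewrite ler_nat.
  have h4 : 2 ^+ m * B <= 2 * K%:R * (F.+1%:R * (K%:R `^ alpha)^-1).
    apply: ler_pM h1 _ => //.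
    by apply: ler_pM h3 h2; [exact: ler0n|exact: powR_ge0].
  rewrite -mulrA (_ : 1440 * _ * _ = 720 * (2 * K%:R * (F.+1%:R * (K%:R `^ alpha)^-1))).
    by apply: ler_wpM2l h4; exact: ler0n.
  by field; rewrite gt_eqF.
have small : 4 * (size (box A N))%:R * (720 * 2 ^+ m * B) <= K%:R * s ^+ 2.
  have -> : K%:R * s ^+ 2 = 4 * (3 ^+ d * (s ^+ 2 / D * K%:R `^ alpha)) *
      (1440 * F.+1%:R * (K%:R / K%:R `^ alpha)).
    have -> : 4 * (3 ^+ d * (s ^+ 2 / D * K%:R `^ alpha)) *
      (1440 * F.+1%:R * (K%:R / K%:R `^ alpha)) =
        D * (s ^+ 2 / D) * (K%:R * (K%:R `^ alpha / K%:R `^ alpha)).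
      by rewrite {2}/D; ring.
    by rewrite divff ?gt_eqF// mulr1 [D * _]mulrC divfK ?gt_eqF// mulrC.
  have [x0 y0] : 0 <= 4 * (size (box A N))%:R :> R /\ 0 <= 720 * 2 ^+ m * B.
    split; first by apply: mulr_ge0; exact: ler0n.
    by apply: mulr_ge0 B0; apply: mulr_ge0 (exprn_ge0 _ _); exact: ler0n.
  apply: ler_pM x0 y0 _ K2; apply: ler_wpM2l; first exact: ler0n.
  apply: (le_trans bN); apply: ler_wpM2l Nd; exact: exprn_ge0.
have am :=
  averaged_moment_ge hH isoU psi1 basis p0 calc spec mG B0 hB Kpos Km s0 small.
refine (le_trans _ am).
rewrite lee_fin [p * _]mulrC powRrM -(mulrA (s / 8)).
rewrite -powRM ?powR_ge0 ?(ltW c'0)// [leRHS]mulrC.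
apply: ler_wpM2l; first by rewrite divr_ge0// ltW.
apply: ge0_ler_powR => //; rewrite ?nnegrE ?(ltW p0)//.
by rewrite mulr_ge0 ?powR_ge0// ltW.
Qed.

Lemma upper_hausdorff_dim_le_exponent :
  (upper_hausdorff_dim mu / (d%:R)%:E <= lower_transport_exponent dot U psi A phi p)%E.
Proof.
have dR : 0 < d%:R :> R by rewrite ltr0n.
rewrite leNgt; apply/negP => lt.
have le0 := lower_transport_exponent_ge0.
have [l el] : exists l : R, lower_transport_exponent dot U psi A phi p = l%:E.
  case: (lower_transport_exponent dot U psi A phi p) lt le0 => [l _ _|//|//].
    by exists l.
  by rewrite ltNge leey.
move: lt le0; rewrite el lee_fin inver gt_eqF// lte_pdivlMr// -EFinM => lt l0.
(* If the exponent were a real [l] below the bound, any [alpha] between [l * d]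
   and the dimension would contradict the growth of the moments; [l >= 0]
   ensures [alpha > 0]. *)
have [alpha la ad] : exists2 alpha : R,
    l * d%:R < alpha & (alpha%:E < upper_hausdorff_dim mu)%E.
  case: (upper_hausdorff_dim mu) lt => [D|_|//].
    by rewrite lte_fin => /midf_lt[h1 h2]; exists ((l * d%:R + D) / 2).
  by exists (l * d%:R + 1); rewrite ?ltrDl ?ltry.
have a0 : 0 < alpha by apply: le_lt_trans la; rewrite mulr_ge0// ltW.
have lad : l < alpha / d%:R by rewrite ltr_pdivlMr.
have [c c0 [K0 hK]] := averaged_moment_power a0 ad.
have e0 : 0 < (alpha / d%:R - l) / 2 by rewrite divr_gt0// subr_gt0.
have [K1 hK1] := log_ratio_ge (alpha / d%:R) c0 e0 p0.
have : ((alpha / d%:R - (alpha / d%:R - l) / 2)%:E <=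
    lower_transport_exponent dot U psi A phi p)%E.
  apply: (@limn_einf_ge _ _ _ (maxn K0 K1)) => K; rewrite geq_max => /andP[k0 k1].
  by apply: hK1 => //; exact: hK.
rewrite el lee_fin; lra.
Qed.

End lower_bound.

Theorem corollary3p13 (R : realType) (H : completeNormedModType R[i])
    (dot : {dot H for @Num.conj R[i]}) (hH : hilbert_norm dot)
    (hsep : separable H)
    (U : {linear H -> H}) (hU : unitary dot U)
    (psi : H) (hpsi : `|psi| = 1)
    (d : nat) (hd : (1 <= d)%N)
    (A : set {ffun 'I_d -> int})
    (hA : A = @positive_lattice d \/ A = @lattice d)
    (phi : {ffun 'I_d -> int} -> H) (hphi : orthonormal_basis dot A phi)
    (mu : {finite_measure set (borel (circle R)) -> \bar R})
    (hmu : spectral_measure dot U psi mu)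
    (p : R) (hp : 0 < p) :
  (upper_hausdorff_dim mu / (d%:R)%:E <=
     lower_transport_exponent dot U psi A phi p)%E.
Proof.
exact: (upper_hausdorff_dim_le_exponent hH (proj1 hU) hpsi hd hphi hmu hp).
Qed.
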